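(* Let $A$ be Gijswijt's sequence. For every integer $n\geq 4$ there is a real number $\alpha\in(n-2,n-1)$ (depending on $n$) such that the first occurrence of $n$ in $A$ is at position $$2^{2^{3^{4^{\cdot^{\cdot^{\cdot^{(n-2)^{\alpha}}}}}}}},$$ that is, at position $2\uparrow(2\uparrow(3\uparrow(4\uparrow(\cdots\uparrow((n-2)\uparrow\alpha)))))$, where $x\uparrow y=x^y$. (The bases, from bottom to top, are $2$ followed by $2,3,4,\dots,n-2$, and the topmost exponent is $\alpha$; for $n=4$ the expression is $2^{2^{\alpha}}$, for $n=5$ it is $2^{2^{3^{\alpha}}}$.)
   Context: For a finite nonempty string $S$ of positive integers, the curling number $\mathcal{C}(S)$ is the largest integer $k$ such that $S=XY^k$ for some strings $X,Y$ with $Y$ nonempty ($X$ may be empty), where $Y^k$ denotes the concatenation of $k$ copies of $Y$. Gijswijt's sequence $A=A(1),A(2),\dots$ is defined by $A(1):=1$ and $A(n+1):=\mathcal{C}(A(1),A(2),\dots,A(n))$ for all $n\geq 1$. Positions are indexed from $1$; the first occurrence of $n$ is at position $p$ if $p$ is the smallest index with $A(p)=n$. *)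

(* Defs.v *)
From mathcomp Require Import all_boot all_order all_algebra.
From mathcomp Require Import all_classical all_reals all_analysis.

Set Implicit Arguments.
Unset Strict Implicit.
Unset Printing Implicit Defensive.

Definition str_pow (Y : seq nat) (k : nat) : seq nat := flatten (nseq k Y).

Definition ends_in_power (S : seq nat) (k : nat) : Prop :=
  exists X Y : seq nat, Y <> [::] /\ S = X ++ str_pow Y k.

(* The bound [k <= size S] loses nothing, since [Y] is nonempty; [curlingP]
   states the maximality over all [k]. *)
Definition curling (S : seq nat) : nat :=
  \max_(k < (size S).+1 | `[< ends_in_power S k >]) k.

Lemma ends_in_power_bound (S : seq nat) (k : nat) :
  ends_in_power S k -> k <= size S.
Proof.
case=> X [[|y Y] [// _ ->]]; rewrite size_cat /str_pow size_flatten /shape.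
rewrite map_nseq sumn_nseq mulnC.
by apply: leq_trans (leq_addl _ _); rewrite leq_pmulr.
Qed.

Lemma curlingP (S : seq nat) : S <> [::] ->
  ends_in_power S (curling S) /\
  forall k, ends_in_power S k -> k <= curling S.
Proof.
move=> S0; have S1 : ends_in_power S 1.
  by exists [::], S; split=> //; rewrite /str_pow /= cats0.
split; last first.
  move=> k Sk; have kS : k < (size S).+1 by rewrite ltnS ends_in_power_bound.
  by rewrite (bigmax_sup (Ordinal kS))//; apply/asboolP.
have lt1 : 1 < (size S).+1 by rewrite ltnS ends_in_power_bound.
rewrite /curling (bigmax_eq_arg (Ordinal lt1)); last exact/asboolP.
by case: arg_maxnP => [|i /asboolP]//; apply/asboolP.
Qed.

(* The first [n.+1] terms of the sequence. *)
Definition gijswijt_prefix (n : nat) : seq nat :=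
  iter n (fun S => rcons S (curling S)) [:: 1].

(* Positions start at 1; the value at 0 is junk. *)
Definition gijswijt (p : nat) : nat := last 0 (gijswijt_prefix p.-1).

Lemma gijswijt_prefixE (n : nat) :
  gijswijt_prefix n = [seq gijswijt i | i <- iota 1 n.+1].
Proof.
elim: n => // n IH; rewrite -[n.+2]addn1 iotaD map_cat -IH add1n /= cats1.
by congr rcons; rewrite /gijswijt /= last_rcons.
Qed.

Lemma gijswijt1 : gijswijt 1 = 1.
Proof. by []. Qed.

Lemma gijswijtS (n : nat) : 1 <= n ->
  gijswijt n.+1 = curling [seq gijswijt i | i <- iota 1 n].
Proof.
by case: n => // n _; rewrite -gijswijt_prefixE /gijswijt /= last_rcons.
Qed.

Definition first_occurrence (n p : nat) : Prop :=
  [/\ 1 <= p, gijswijt p = n & forall q, 1 <= q -> gijswijt q = n -> p <= q].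

(* [tower [:: b1; ..; bm] x] is b1 ^ (b2 ^ (.. ^ (bm ^ x))). *)
Definition tower (R : realType) (bs : seq nat) (x : R) : R :=
  foldr (fun b y => powR b%:R y) x bs.

(* Main.v *)
Require Import Defs.
From mathcomp Require Import all_boot all_order all_algebra.
From mathcomp Require Import all_classical all_reals all_analysis.
From mathcomp Require Import zify.

(** Write C for the curling number. For m >= 1 let the sequence of level m start
with m and continue with max(m, C(prefix)); level 1 is Gijswijt's sequence.
Call a nonempty prefix of it a cut if its curling number is less than m: at
the cuts, and only there, the maximum overrules the curling number.

Put b = m + 1, let T_0, T_1, ... be the cuts of level b in increasing order,
and let v(i) be the exponent of the largest power of b that divides i. The
sequence of level m is
    m^b T_v(1) m^b T_v(2) m^b T_v(3) ...
([gprefix_word]). Indeed, suppose that a prefix of this string ends in Y^k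
with k >= 2. If Y does not contain m, then Y^k lies in the last run of letters
other than m, which is a prefix of level b, so level b sees the same power. If
Y contains m, the markers m^b allow the blocks to be read off, and a power of
blocks is a power in the ruler sequence v(1), v(2), ... ([blocks_nseq_power],
[blocks_run_power]). The ruler sequence has no b-th powers, and a k-th power
that ends at v(i) forces a base-b digit of i to be at least k ([ruler_power]).
Hence the powers that involve m have exponent at most b, they reach b exactly
when the current run still has to pass an earlier cut, and they drop below b
when the run is T_v(i), so that the next term is m again.

The same analysis finds the cuts of level m, for m >= 2. After i complete
blocks, appending m^j with 0 < j < m gives a cut exactly if no base-b digit of
i equals m; the only other possible cuts are the ends of blocks, again for i
without the digit m. Since m^k of the numbers below b^k avoid one digit, this
counts the cuts. Now let n > m first occur in level b after k cuts. In level m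
it first occurs in block number b^k, the first block that carries T_k, and so
after at least (m - 1) m^k and fewer than m^(k+1) cuts
([first_at_ncut_bounds]).

Starting from level n, whose first term is n, and descending, the number of
cuts of level m before n lies between the towers with bases m, ..., n - 2 and
top exponents n - 2 and n - 1 ([first_at_tower_bounds]). At level 1 a length
estimate turns k cuts of level 2 into a position between 2^(k+1) and
16^(k+1) = 2^(4(k+1)) ([first_at1_length]). The lost factor 4 in the exponent
is regained at level 3, where two candidates for cuts turn out not to be cuts
([first_at3_ncut]). This needs n >= 5; the first 4 is found by computation, at
position 220. Finally the real tower is increasing in its top exponent and can
be inverted by logarithms, which produces the number alpha ([tower_between]). *)

Set Implicit Arguments.
Unset Strict Implicit.
Unset Printing Implicit Defensive.

(** * Powers at the end of a string *)

Lemma str_powS (Y : seq nat) k : str_pow Y k.+1 = Y ++ str_pow Y k.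
Proof. by []. Qed.

Lemma str_powD (Y : seq nat) k l :
  str_pow Y (k + l) = str_pow Y k ++ str_pow Y l.
Proof. by rewrite /str_pow nseqD flatten_cat. Qed.

Lemma str_pow1 (Y : seq nat) : str_pow Y 1 = Y.
Proof. exact: cats0. Qed.

Lemma str_powSr (Y : seq nat) k : str_pow Y k.+1 = str_pow Y k ++ Y.
Proof. by rewrite -addn1 str_powD str_pow1. Qed.

Lemma size_str_pow (Y : seq nat) k : size (str_pow Y k) = k * size Y.
Proof. by rewrite /str_pow size_flatten /shape map_nseq sumn_nseq mulnC. Qed.

Lemma str_pow_rot (U V : seq nat) k :
  str_pow (U ++ V) k ++ U = U ++ str_pow (V ++ U) k.
Proof.
elim: k => [|k IH]; first by rewrite cats0.
by rewrite !str_powS -!catA IH.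
Qed.

Lemma nth_str_pow (Y : seq nat) k y : y < k * size Y ->
  nth 0 (str_pow Y k) y = nth 0 Y (y %% size Y).
Proof.
elim: k y => // k IH y; rewrite mulSn => yk.
rewrite str_powS nth_cat; case: ltnP => yY; first by rewrite modn_small.
rewrite IH; last lia.
by rewrite -[in RHS](subnK yY) modnDr.
Qed.

Lemma str_pow_nseq (x j k : nat) : str_pow (nseq j x) k = nseq (k * j) x.
Proof. by elim: k => // k IH; rewrite str_powS IH mulSn nseqD. Qed.

Lemma ends_in_powerW (S : seq nat) k l :
  l <= k -> ends_in_power S k -> ends_in_power S l.
Proof.
move=> lk [X [Y [Y0 ->]]]; exists (X ++ str_pow Y (k - l)), Y; split => //.
by rewrite -catA -str_powD subnK.
Qed.

Lemma ends_in_power_catl (X S : seq nat) k :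
  ends_in_power S k -> ends_in_power (X ++ S) k.
Proof. by case=> U [Y [Y0 ->]]; exists (X ++ U), Y; rewrite catA. Qed.

Lemma leq_curlingP (S : seq nat) k : reflect (ends_in_power S k) (k <= curling
  S).
Proof.
case: S => [|x S]; apply: (iffP idP).
- rewrite /curling big_mkcond big_ord1 /=.
  case: ifP => _; rewrite leqn0 => /eqP ->;
  by exists [::], [:: 0].
- by move/ends_in_power_bound; rewrite leqn0 => /eqP ->.
- have /curlingP[pw _] : x :: S <> [::] by [].
  by move=> /ends_in_powerW; apply.
- have /curlingP[_ h] : x :: S <> [::] by [].
  exact: h.
Qed.

Lemma leq_curling_catl (X S : seq nat) : curling S <= curling (X ++ S).
Proof. exact/leq_curlingP/ends_in_power_catl/leq_curlingP. Qed.

Lemma curling_gt0 (S : seq nat) : S <> [::] -> 0 < curling S.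
Proof. by move=> S0; apply/leq_curlingP; exists [::], S; rewrite str_pow1. Qed.

Lemma curling_leq_size (S : seq nat) : curling S <= size S.
Proof. exact/ends_in_power_bound/leq_curlingP. Qed.

(** Powers as periods: a suffix is a k-th power of a word of length d if and
only if it has length k * d and period d. This is the form in which powers of
the ruler sequence are analysed and in which powers are searched for by
computation. *)
Lemma ends_in_powerP (S : seq nat) k :
  ends_in_power S k <-> exists d, [/\ 0 < d, k * d <= size S &
    forall x, size S - k * d <= x -> x + d < size S ->
      nth 0 S x = nth 0 S (x + d)].
Proof.
split=> [[X [Y [Y0 ->]]]|[d [d0 dS per]]].
  exists (size Y); rewrite size_cat size_str_pow; split.
  - by case: Y Y0.
  - by rewrite leq_addl.
  - rewrite addnK => x Xx xS; rewrite !nth_cat.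
    rewrite !ifN ?nth_str_pow; try lia.
    by rewrite -addnBAC // modnDr.
set a := size S - k * d in per.
have aS : a + k * d = size S by rewrite subnK.
have sz : size (drop a S) = k * d by rewrite size_drop; lia.
case: (posnP k) => [->|k0]; first by exists S, [:: 0]; rewrite cats0.
have szt : size (take d (drop a S)) = d.
  by rewrite size_takel // sz leq_pmull.
exists (take a S), (take d (drop a S)); split.
  by move=> E; rewrite E in szt; rewrite -szt in d0.
rewrite -[LHS](cat_take_drop a); congr (_ ++ _).
apply: (@eq_from_nth _ 0); first by rewrite size_str_pow szt.
rewrite sz => y ykd; rewrite nth_str_pow szt // nth_take ?ltn_pmod //.
rewrite (divn_eq y d) in ykd *; rewrite modnMDl modn_mod.
elim: (y %/ d) ykd => // q IH; rewrite !nth_drop => ykd.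
rewrite mulSn in ykd *; have -> : a + (d + q * d + y %% d) = a + (q * d + y %%
  d) + d by lia.
rewrite -per; [|lia|lia]; rewrite -nth_drop IH ?nth_drop //; lia.
Qed.

(** * The ruler sequence *)

(** The exponent of the largest power of [b] dividing [i]; [logn] would only do
for prime [b]. *)
Definition ruler (b i : nat) : nat := \max_(e < i.+1 | b ^ e %| i) e.

Lemma leq_ruler b i e : 1 < b -> 0 < i -> (e <= ruler b i) = (b ^ e %| i).
Proof.
move=> b1 i0; apply/idP/idP => [|di].
  have h0 : #|[pred e : 'I_i.+1 | b ^ e %| i]| > 0.
    by apply/card_gt0P; exists ord0; rewrite inE expn0 dvd1n.
  rewrite /ruler; have [e0 h ->] := eq_bigmax_cond (fun e : 'I_i.+1 => e : nat)
    h0.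
  rewrite inE in h => le; apply: dvdn_trans h; exact: dvdn_exp2l.
have lte : e < i.+1.
  rewrite ltnS; apply: ltnW; apply: leq_trans (dvdn_leq i0 di).
  exact: ltn_expl.
exact: (leq_bigmax_cond (Ordinal lte)).
Qed.

Lemma eq_ruler b i j : 1 < b -> 0 < i -> 0 < j ->
  (forall e, (b ^ e %| i) = (b ^ e %| j)) -> ruler b i = ruler b j.
Proof.
move=> b1 i0 j0 h; apply/eqP; rewrite eqn_leq.
by rewrite !leq_ruler // -h -leq_ruler // h -leq_ruler // !leqnn.
Qed.

Lemma ruler_mul b i : 1 < b -> 0 < i -> ruler b (b * i) = (ruler b i).+1.
Proof.
move=> b1 i0; have bi0 : 0 < b * i by rewrite muln_gt0 i0 (ltnW b1).
apply/eqP; rewrite eqn_leq leq_ruler // expnS dvdn_pmul2l ?(ltnW b1) //.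
rewrite -leq_ruler // leqnn andbT.
case: (posnP (ruler b (b * i))) => [->//|r0].
rewrite -(prednK r0) ltnS leq_ruler // -(@dvdn_pmul2l b) ?(ltnW b1) //.
by rewrite -expnS prednK // -leq_ruler.
Qed.

Lemma ruler_eq0 b i : 1 < b -> 0 < i -> (ruler b i == 0) = ~~ (b %| i).
Proof. by move=> b1 i0; rewrite -leqn0 leqNgt leq_ruler // expn1. Qed.

Lemma ruler_exp b e : 1 < b -> ruler b (b ^ e) = e.
Proof.
move=> b1; elim: e => [|e IH]; last by rewrite expnS ruler_mul ?expn_gt0 ?(ltnW
  b1) // IH.
by apply/eqP; rewrite ruler_eq0 // dvdn1; lia.
Qed.

Lemma ruler_lt b i e : 1 < b -> 0 < i -> i < b ^ e -> ruler b i < e.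
Proof.
move=> b1 i0 ie; rewrite ltnNge leq_ruler //; apply/negP => /dvdn_leq.
by move/(_ i0); rewrite leqNgt ie.
Qed.

(** If the period is not divisible by [b], a window of two periods cannot contain
a multiple of [b], because a shift by the period would move it to a
non-multiple. So the window lies between two multiples of [b] and the last
digit of [i] is at least its length. If the period is divisible by [b], only
the multiples of [b] matter: dividing by [b] removes the last digit of [i]. *)
Lemma ruler_power b i d k : 1 < b -> 0 < d -> 1 < k -> k * d <= i ->
  (forall x, i - k * d < x -> x + d <= i -> ruler b x = ruler b (x + d)) ->
  exists f, k <= (i %/ b ^ f) %% b.
Proof.
move=> b1; elim/ltn_ind: d i => d IH i d0 k1 kdi per.
have b0 : 0 < b by apply: ltnW.
have kd : 2 * d <= k * d by rewrite leq_mul2r k1 orbT.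
case: (boolP (b %| d)) => [/dvdnP[d' dE]|nbd].
  have d'0 : 0 < d' by case: d' dE d0 => // ->.
  have [|//|//|||f fP] := IH d' _ (i %/ b).
  - by rewrite dE -[X in X < _]muln1 ltn_pmul2l.
  - by rewrite leq_divRL // -mulnA -dE.
  - move=> x x1 x2; have x0 : 0 < x by lia.
    apply/eqP; rewrite -eqSS -!ruler_mul //; last lia.
    rewrite mulnDr (mulnC b d') -dE; apply/eqP/per.
      have := divn_eq i b; have := ltn_pmod i b0; rewrite dE in kdi *.
      have : (i %/ b - k * d').+1 * b <= x * b by rewrite leq_mul2r x1 orbT.
      rewrite mulSn mulnBl -mulnA; nia.
    rewrite dE mulnC -mulnDl -leq_divRL //.
  by exists f.+1; rewrite expnS divnMA.
exists 0; rewrite expn0 divn1 leqNgt; apply/negP => ik.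
have kd' : k <= k * d by rewrite leq_pmulr.
set x := (i %/ b) * b; have xE : i = x + i %% b by exact: divn_eq.
have x0 : 0 < x by lia.
have bx : b %| x by apply: dvdn_mull.
have nz y : 0 < y -> ruler b x = ruler b y -> b %| y.
  by move=> y0 E; rewrite -[b]expn1 -leq_ruler // -E leq_ruler // expn1.
case: (leqP (x + d) i) => xd.
  by have := nz _ _ (per _ _ xd); rewrite dvdn_addr // (negbTE nbd) => H;
    have := H _ _; lia.
have xmd : x - d + d = x by lia.
have /nz : ruler b x = ruler b (x - d).
  by rewrite -{1}xmd -per //; lia.
move=> /(_ _)H; have {H} : b %| x - d by apply: H; lia.
by rewrite dvdn_subr ?(negbTE nbd) //; lia.
Qed.

Definition ruler_seq (b i : nat) : seq nat := [seq ruler b x | x <- iota 1 i].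

Lemma size_ruler_seq b i : size (ruler_seq b i) = i.
Proof. by rewrite size_map size_iota. Qed.

Lemma nth_ruler_seq b i x : x < i -> nth 0 (ruler_seq b i) x = ruler b x.+1.
Proof. by move=> xi; rewrite (nth_map 0) ?size_iota // nth_iota. Qed.

Lemma ruler_seqS b i : ruler_seq b i.+1 = rcons (ruler_seq b i) (ruler b i.+1).
Proof. by rewrite /ruler_seq -{1}[i.+1]addn1 iotaD map_cat cats1 add1n. Qed.

Lemma ruler_seq_power b i k : 1 < b -> 1 < k ->
  ends_in_power (ruler_seq b i) k -> exists f, k <= (i %/ b ^ f) %% b.
Proof.
move=> b1 k1 /ends_in_powerP[d [d0]]; rewrite size_ruler_seq => kdi per.
apply: (ruler_power b1 d0 k1 kdi) => -[//|x] xi xdi.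
by have := per x; rewrite !nth_ruler_seq ?addSn //; try lia; apply; lia.
Qed.

(** Digits in base [b] are smaller than [b]. *)
Lemma ruler_seq_powerN b i : 1 < b -> ~ ends_in_power (ruler_seq b i) b.
Proof.
move=> b1 /(ruler_seq_power b1 b1)[f]; apply/negP.
by rewrite -ltnNge ltn_pmod // ltnW.
Qed.

(** Inside a stretch between consecutive multiples of [b ^ f.+1], a shift by
[b ^ f] does not change the divisibility by any power of [b]. *)
Lemma ruler_shift b f N y : 1 < b -> b ^ f.+1 %| N ->
  N - b ^ f.+1 < y -> y + b ^ f < N -> ruler b y = ruler b (y + b ^ f).
Proof.
move=> b1 dN Ny yN.
have b0 : 0 < b by exact: ltnW.
have bf0 : 0 < b ^ f by rewrite expn_gt0 b0.
have NN : b ^ f.+1 <= N by apply: dvdn_leq => //; lia.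
have nd z : N - b ^ f.+1 < z -> z < N -> ~~ (b ^ f.+1 %| z).
  move=> z1 z2; apply/negP => dz.
  have /dvdn_leq : b ^ f.+1 %| N - z by rewrite dvdn_sub.
  by lia.
apply: eq_ruler => //; try lia.
move=> e; case: (leqP e f) => ef.
  by rewrite dvdn_addl // dvdn_exp2l.
have h z : ~~ (b ^ f.+1 %| z) -> (b ^ e %| z) = false.
  by move=> /negP nz; apply/negP => dz; apply: nz; apply: dvdn_trans dz;
    apply: dvdn_exp2l.
by rewrite !h //; apply: nd; lia.
Qed.

(** A converse to [ruler_seq_power] for the largest digit: it makes the last
[b.-1] stretches of length [b ^ f] contain no multiple of [b ^ f.+1]. *)
Lemma ruler_seq_digit b i f : 1 < b -> (i %/ b ^ f) %% b = b.-1 ->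
  ends_in_power (ruler_seq b i) b.-1.
Proof.
move=> b1 dig.
have bf0 : 0 < b ^ f by rewrite expn_gt0 (ltnW b1).
set q := i %/ b ^ f in dig; set N := q.+1 * b ^ f.
have dN : b ^ f.+1 %| N.
  by rewrite expnS dvdn_pmul2r // /dvdn -addn1 -modnDml dig addn1 prednK ?modnn
    // ltnW.
have iN : i < N by rewrite -ltn_divLR.
have qi : q * b ^ f <= i by rewrite leq_divM.
have bq : b <= q.+1.
  have : b %| q.+1 by move: dN; rewrite expnS dvdn_pmul2r.
  by move/dvdn_leq; apply.
have E : b.-1 * b ^ f + b ^ f = b ^ f.+1 by rewrite -mulSnr prednK ?expnS //
  ltnW.
have qN : q * b ^ f + b ^ f = N by rewrite -mulSnr.
have bN : b ^ f.+1 <= N by rewrite expnS leq_mul2r bq orbT.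
apply/ends_in_powerP; exists (b ^ f); rewrite size_ruler_seq; split => //;
  first by lia.
move=> x x1 x2; rewrite !nth_ruler_seq //; last by lia.
rewrite -addSn; apply: (ruler_shift b1 dN); lia.
Qed.

(** Just before a multiple of [b ^ e.+1] the ruler sequence is one letter short
of a [b]-th power, and that letter is [e]. This is why a run that is to go
beyond the cut number [e] is not stopped there. *)
Lemma ruler_seq_rcons b i e : 1 < b -> b ^ e.+1 %| i.+1 ->
  ends_in_power (rcons (ruler_seq b i) e) b.
Proof.
move=> b1 dN.
have b0 : 0 < b by exact: ltnW.
have be0 : 0 < b ^ e by rewrite expn_gt0 b0.
have NN : b ^ e.+1 <= i.+1 by apply: dvdn_leq.
have be2 : b ^ e + b ^ e <= b ^ e.+1 by rewrite expnS addnn -mul2n leq_mul2r b1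
  orbT.
apply/ends_in_powerP; exists (b ^ e); rewrite size_rcons size_ruler_seq -expnS.
split => // x x1 x2; rewrite !nth_rcons size_ruler_seq.
have xi : x < i by lia.
rewrite xi nth_ruler_seq //.
case: (ltngtP (x + b ^ e) i) => xe; last 1 first.
- have xE : x.+1 + b ^ e = i.+1 by lia.
  apply/eqP; rewrite eqn_leq leqNgt !leq_ruler //; apply/andP; split.
    apply/negP => dx; have := dvdn_sub dN dx.
    rewrite -xE addnC addnK dvdn_Pexp2l // ltnn //.
  have : b ^ e %| x.+1 + b ^ e.
    by rewrite xE; apply: dvdn_trans dN; apply: dvdn_exp2l.
  by rewrite dvdn_addl.
- rewrite nth_ruler_seq // -addSn; apply: (ruler_shift b1 dN); lia.
- by lia.
Qed.

(** * Reading off the blocks of a string *)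

Lemma run_split (m : nat) (u u' V V' : seq nat) : m \notin u -> m \notin u' ->
  head m V = m -> head m V' = m -> u ++ V = u' ++ V' -> u = u' /\ V = V'.
Proof.
elim: u u' => [|x u IH] [|x' u'] //=.
- by move=> _; rewrite inE negb_or => /andP[h _] hV _ E; rewrite E /= in hV;
  rewrite hV eqxx in h.
- by rewrite inE negb_or => /andP[h _] _ _ hV E; rewrite -E /= in hV;
  rewrite hV eqxx in h.
rewrite !inE !negb_or => /andP[_ hu] /andP[_ hu'] hV hV' [-> E].
by have [-> ->] := IH _ hu hu' hV hV' E.
Qed.

Lemma run_splitr (m : nat) (u u' V V' : seq nat) : m \notin u -> m \notin u' ->
  last m V = m -> last m V' = m -> V ++ u = V' ++ u' -> u = u' /\ V = V'.
Proof.
have lr (s : seq nat) : last m s = m -> head m (rev s) = m.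
  by case/lastP: s => // s x; rewrite last_rcons rev_rcons.
move=> hu hu' /lr hV /lr hV' /(congr1 rev); rewrite !rev_cat => E.
have [||E1 E2] := @run_split m _ _ _ _ _ _ hV hV' E; rewrite ?mem_rev //.
by rewrite -(revK u) -(revK V) E1 E2 !revK.
Qed.

Lemma cat_nseq_split (m : nat) (A B Y : seq nat) j : A ++ nseq j m = B ++ Y ->
  last m.+1 A != m -> ~~ all (pred1 m) Y ->
  exists Y', [/\ Y = Y' ++ nseq j m, A = B ++ Y', last m.+1 Y' != m & Y' <>
    [::]].
Proof.
move=> E lA nY.
have jY : j < size Y.
  rewrite ltnNge; apply: contra nY => Yj.
  have := congr1 (drop (size B)) E;
    rewrite (drop_size_cat _ (erefl (size B))) => <-.
  have := congr1 size E; rewrite !size_cat size_nseq => sz.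
  rewrite drop_cat ifN; last by lia.
  by rewrite drop_nseq all_nseq /= eqxx orbT.
have E' : A ++ nseq j m = (B ++ take (size Y - j) Y) ++ drop (size Y - j) Y.
  by rewrite -catA cat_take_drop.
have sA : size A = size (B ++ take (size Y - j) Y).
  have := congr1 size E; rewrite !size_cat size_takel ?size_nseq; lia.
move/eqP: E'; rewrite eqseq_cat // => /andP[/eqP AE /eqP YE].
exists (take (size Y - j) Y); rewrite YE cat_take_drop; split=> //.
  have : 0 < size (take (size Y - j) Y) by rewrite size_takel; lia.
  by move: lA; rewrite AE last_cat; case: (take _ _).
by move/(congr1 size); rewrite size_takel /=; lia.
Qed.

Section Blocks.
Variables (m M : nat) (T : nat -> seq nat).
Hypothesis M0 : 0 < M.
Hypothesis T_m : forall e, m \notin T e.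
Hypothesis T0 : forall e, T e <> [::].
Hypothesis T_inj : injective T.

Definition block e := nseq M m ++ T e.
Definition blocks (w : seq nat) := flatten [seq block e | e <- w].

Lemma blocks_cons e w : blocks (e :: w) = nseq M m ++ T e ++ blocks w.
Proof. by rewrite /blocks /= -catA. Qed.

Lemma blocks_cat w w' : blocks (w ++ w') = blocks w ++ blocks w'.
Proof. by rewrite /blocks map_cat flatten_cat. Qed.

Lemma blocks_rcons w e : blocks (rcons w e) = blocks w ++ nseq M m ++ T e.
Proof. by rewrite -cats1 blocks_cat /blocks /= cats0. Qed.

Lemma blocks_pow w k : blocks (str_pow w k) = str_pow (blocks w) k.
Proof. by elim: k => // k IH; rewrite !str_powS blocks_cat IH. Qed.

Lemma head_blocks w : head m (blocks w) = m.
Proof. by case: w => //= e w; rewrite blocks_cons; case: M M0. Qed.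

Lemma last_T e x : last x (T e) != m.
Proof.
have := T_m e; have := @T0 e; case: (T e) => // y s _ /=.
by apply: contraNneq => <-; exact: mem_last.
Qed.

Lemma last_blocks w : last m.+1 (blocks w) != m.
Proof.
elim/last_ind: w => [|w e _]; first by rewrite /=; lia.
by rewrite blocks_rcons !last_cat last_T.
Qed.

Lemma blocks_inj : injective blocks.
Proof.
elim=> [|e w IH] [|e' w'] //.
- by rewrite blocks_cons; case: M M0.
- by rewrite blocks_cons; case: M M0.
rewrite !blocks_cons => /eqP; rewrite eqseq_cat // eqxx /= => /eqP E.
have [||||/T_inj -> /IH -> //] := @run_split m _ _ _ _ _ _ _ _ E;
  by rewrite ?head_blocks ?T_m.
Qed.

(** A string of blocks can only be cut at a place where a block starts. Such a
place is recognized by a letter [m] that either follows a different letter or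
is the first of [M] consecutive ones, since the runs of [m] have length [M]. *)
Lemma blocks_split w (U V : seq nat) : blocks w = U ++ V ->
  head m V = m -> last m.+1 U != m \/ take M V = nseq M m ->
  exists w1 w2, [/\ w = w1 ++ w2, U = blocks w1 & V = blocks w2].
Proof.
elim: w U => [|e w IH] U.
  case: U => [|//] /= <- _ _; by exists [::], [::].
case: (posnP (size U)) => [/size0nil ->|U0] E hV cond.
  by exists [::], (e :: w).
case: (leqP (size (block e)) (size U)) => sz.
  have [U' UE] : exists U', U = block e ++ U'.
    exists (drop (size (block e)) U).
    rewrite -[LHS](cat_take_drop (size (block e))); congr (_ ++ _).
    have := congr1 (take (size (block e))) E.
    rewrite take_cat ltn_neqAle sz andbT.
    rewrite [blocks _](_ : _ = block e ++ blocks w) // take_size_cat //.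
    case: eqP => [sE|_] h; last by [].
    by rewrite sE take_size h sE subnn take0 cats0.
  have E' : blocks w = U' ++ V.
    move: E; rewrite UE [blocks _](_ : _ = block e ++ blocks w) // -catA.
    by move/eqP; rewrite eqseq_cat // eqxx => /eqP.
  have [||w1 [w2 [-> U'E ->]]] := IH _ E' => //.
    case: cond => h; last by right.
    left; move: h; rewrite UE last_cat; case: (U') => //= _; lia.
  by exists (e :: w1), w2; rewrite UE U'E.
(* The cut falls strictly inside the first block. The letter after it is [m], so
   it lies in the marker, where neither criterion for a start is met. *)
exfalso; have szE : size (block e) = M + size (T e) by rewrite size_cat
  size_nseq.
have T1 : 0 < size (T e) by have := @T0 e; case: (T e).
have V0 : 0 < size V.
  have := congr1 size E; rewrite [blocks _](_ : _ = block e ++ blocks w) //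
    !size_cat size_nseq.
  by lia.
have nE x : x < size (block e) -> nth m.+1 (block e) x = nth m.+1 (U ++ V) x.
  by move=> xe; rewrite -E [blocks _](_ : _ = block e ++ blocks w) // nth_cat
    xe.
have nT x : M <= x -> x < size (block e) -> nth m.+1 (block e) x != m.
  move=> Mx xe; rewrite nth_cat size_nseq ltnNge Mx /=.
  have : nth m.+1 (T e) (x - M) \in T e by rewrite mem_nth // ltn_subLR // -szE.
  by apply: contraTneq => ->; exact: T_m.
have hV' : nth m.+1 (U ++ V) (size U) = m.
  by rewrite nth_cat ltnn subnn nth0; move: V0 hV; case: (V).
have UM : size U < M.
  by rewrite ltnNge; apply/negP => UM; have := nT _ UM sz;
    rewrite nE // hV' eqxx.
case: cond => [|cond].
  move/negP; apply; apply/eqP.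
  rewrite (last_nth m.+1) -(prednK U0) /=.
  have -> : nth m.+1 U (size U).-1 = nth m.+1 (U ++ V) (size U).-1.
    by rewrite nth_cat prednK // leqnn.
  by rewrite -nE ?nth_cat ?size_nseq ?ifT ?nth_nseq ?ifT //; lia.
have iM : M - size U < M by lia.
have Me : M < size (block e) by lia.
have := nT M (leqnn _) Me; rewrite nE // nth_cat ltnNge (ltnW UM) /=.
by rewrite -[V](cat_take_drop M) cond nth_cat size_nseq iM nth_nseq iM eqxx.
Qed.

Lemma blocks_pow_eq w (Z : seq nat) q : blocks w = str_pow Z q.+1 ->
  Z <> [::] -> head m Z = m -> last m.+1 Z != m \/ take M Z = nseq M m ->
  exists z, Z = blocks z /\ w = str_pow z q.+1.
Proof.
move=> + Z0 hZ cond; elim: q w => [|q IH] w E.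
  by exists w; rewrite !str_pow1 in E *.
rewrite str_powS in E.
have [| |w1 [w2 [wE ZE /esym/IH[z [zE w2E]]]]] := blocks_split E.
- by rewrite str_powS; case: Z Z0 hZ {cond E IH}.
- case: cond; [by left|move=> h; right].
  rewrite str_powS takel_cat // -[X in X <= _](size_nseq M m) -h size_take.
  by case: ifP => // /ltnW.
by exists w1; split=> //; rewrite wE str_powS w2E (blocks_inj (etrans (esym zE)
  ZE)).
Qed.

Lemma blocks_cat_pow w (U Z : seq nat) q : blocks w = U ++ str_pow Z q.+1 ->
  Z <> [::] -> head m Z = m ->
  last m.+1 U != m /\ last m.+1 Z != m \/ take M Z = nseq M m ->
  exists w0 z, [/\ w = w0 ++ str_pow z q.+1, U = blocks w0 & Z = blocks z].
Proof.
move=> E Z0 hZ cond.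
have [| |w1 [w2 [wE ZE /esym E2]]] := blocks_split E.
- by rewrite str_powS; case: Z Z0 hZ {cond E}.
- case: cond => [[h _]|h]; [by left|right].
  rewrite str_powS takel_cat // -[X in X <= _](size_nseq M m) -h size_take.
  by case: ifP => // /ltnW.
have [|z [zE w2E]] := blocks_pow_eq E2 Z0 hZ.
  by case: cond => [[_ h]|h]; [left|right].
by exists w1, z; rewrite wE w2E.
Qed.

(** Rotate [Y] so that it starts with [m]: its copies then are whole strings of
blocks, except that the first one is only known up to its leading letters [m].
As [j < M], at least one of these is present and shows where the block
starts. *)
Lemma blocks_nseq_power w (X Y : seq nat) j k :
  blocks w ++ nseq j m = X ++ str_pow Y k.+2 -> 0 < j < M ->
  ~~ all (pred1 m) Y -> ends_in_power w k.+2.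
Proof.
move=> E /andP[j0 jM] nY; rewrite str_powSr catA in E.
have [Y' [YE bE lY Y'0]] := cat_nseq_split E (last_blocks w) nY.
subst Y; rewrite -catA str_pow_rot catA in bE.
have [||| w0 [z [wE XE ZE]]] := blocks_cat_pow bE.
- by case: (j) j0.
- by case: (j) j0.
- left; rewrite !last_cat; case: (Y') Y'0 lY => //=.
case: z => [|e z] in wE ZE; first by case: (j) j0 ZE.
move: ZE; rewrite blocks_cons -(subnKC (ltnW jM)) nseqD -catA.
move/eqP; rewrite eqseq_cat // eqxx /= => /eqP YE.
move: XE; rewrite YE !catA => /esym XE.
have [| |w1 [w2 [w0E UE /blocks_inj zE]]] := blocks_split XE.
- exact: head_blocks.
- by left; rewrite last_cat last_T.
case/lastP: w1 => [|w1 e'] in w0E UE *.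
  have := congr1 size UE; rewrite !size_cat.
  by have := @T0 e; case: (T e) => //= *; lia.
rewrite blocks_rcons catA in UE.
have lastm k0 : last m (nseq k0 m) = m by elim: k0.
have [|||| /T_inj eE _] := @run_splitr m _ _ _ _ _ _ _ _ UE => //.
- by rewrite last_cat -(prednK (_ : 0 < M - j)) ?subn_gt0 //= lastm.
- by rewrite last_cat -(prednK M0) /= lastm.
exists w1, (e :: z); split=> //.
by rewrite wE w0E -zE -eE cat_rcons str_powS -!catA.
Qed.

(** As in [blocks_nseq_power], but the string now ends inside a run [u]. The
rotation that starts with the last marker costs one copy of [Y], and the first
block of a period is only known to have [u] as a prefix of its run. The last
conclusion records that the rest [s] of this run also occurs before the
periodic part. *)
Lemma blocks_run_power w (u X Y : seq nat) k :
  blocks w ++ nseq M m ++ u = X ++ str_pow Y k.+2 -> m \notin u ->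
  M + size u <= size Y ->
  exists w0 e z s, [/\ w = w0 ++ str_pow (e :: z) k.+1, T e = u ++ s &
    X ++ s ++ blocks z = blocks w0].
Proof.
move=> E mu sY; rewrite str_powSr [X in _ = X]catA in E.
set Y1 := take (size Y - (M + size u)) Y.
have szE : size (blocks w) = size ((X ++ str_pow Y k.+1) ++ Y1).
  by have := congr1 size E; rewrite !size_cat size_nseq size_takel; lia.
have E' := E; rewrite -{2}(cat_take_drop (size Y - (M + size u)) Y) [X in _ =
  X]catA in E'.
move/eqP: E'; rewrite eqseq_cat // => /andP[/eqP bE /eqP YE].
have {YE} YE : Y = Y1 ++ (nseq M m ++ u) by rewrite YE cat_take_drop.
rewrite {1}YE -/Y1 -catA str_pow_rot catA in bE.
have [||| w0 [z [wE XE ZE]]] := blocks_cat_pow bE.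
- by case: M M0.
- by case: M M0.
- by right; rewrite -!catA take_size_cat // size_nseq.
case: z => [|e z] in wE ZE; first by case: M M0 ZE.
move: ZE; rewrite blocks_cons -catA.
move/eqP; rewrite eqseq_cat // eqxx /= => /eqP uE.
have uT : size u <= size (T e).
  rewrite leqNgt; apply/negP => Tu.
  have := congr1 (fun s => nth m s (size (T e))) uE.
  rewrite nth_cat Tu nth_cat ltnn subnn nth0 head_blocks => nE.
  by move: mu; rewrite -nE mem_nth.
have TE : T e = u ++ drop (size u) (T e).
  rewrite -{1}(cat_take_drop (size u) (T e)); congr (_ ++ _).
  have := congr1 (take (size u)) uE; rewrite take_size_cat //.
  by rewrite takel_cat // => <-.
exists w0, e, z, (drop (size u) (T e)); split => //.
rewrite -XE; congr (_ ++ _).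
by apply/eqP; move/eqP: uE; rewrite {1}TE -catA eqseq_cat // eqxx => /eqP ->.
Qed.

End Blocks.

(** * The sequence of level m *)

(** Gijswijt's sequence is the case [m = 1]; the higher levels are needed because
the runs of letters other than [m] in level [m] are prefixes of level
[m.+1]. *)
Fixpoint gprefix (m L : nat) : seq nat :=
  if L is l.+1 then rcons (gprefix m l) (maxn m (curling (gprefix m l)))
  else [::].

Lemma size_gprefix m L : size (gprefix m L) = L.
Proof. by elim: L => //= L IH; rewrite size_rcons IH. Qed.

Lemma take_gprefix m l L : l <= L -> take l (gprefix m L) = gprefix m l.
Proof.
elim: L => [|L IH]; first by rewrite leqn0 => /eqP ->.
rewrite leq_eqVlt => /predU1P[->|];
  first by rewrite take_oversize ?size_gprefix.
by rewrite ltnS => lL; rewrite /= -cats1 takel_cat ?size_gprefix ?IH.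
Qed.

Lemma gprefix_cat m (X V : seq nat) :
  X ++ V = gprefix m (size (X ++ V)) -> X = gprefix m (size X).
Proof.
move=> E; rewrite -(@take_gprefix m (size X) (size (X ++ V))).
  by rewrite -E take_size_cat.
by rewrite size_cat leq_addr.
Qed.

Lemma gprefix_rcons m (X : seq nat) : X = gprefix m (size X) ->
  rcons X (maxn m (curling X)) =
  gprefix m (size (rcons X (maxn m (curling X)))).
Proof. by move=> E; rewrite size_rcons /= -E. Qed.

Lemma gprefix_geq m L x : x \in gprefix m L -> m <= x.
Proof.
elim: L => //= L IH; rewrite mem_rcons inE => /predU1P[->|//].
exact: leq_maxl.
Qed.

(** * The block decomposition of the sequence of level m *)

Lemma notin_str_pow (m k : nat) (Y : seq nat) :
  m \notin Y -> m \notin str_pow Y k.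
Proof. by move=> mY; elim: k => // k IH;
  rewrite str_powS mem_cat negb_or mY. Qed.

Lemma all_str_pow (a : pred nat) k (Y : seq nat) :
  all a Y -> all a (str_pow Y k).
Proof. by move=> aY; elim: k => // k IH; rewrite str_powS all_cat aY. Qed.

Lemma gprefix_nseq M l : l <= M.+1 -> gprefix M l = nseq l M.
Proof.
elim: l => // l IH lM; rewrite /= IH ?(ltnW lM) //.
have /maxn_idPl -> : curling (nseq l M) <= M.
  by apply: leq_trans (curling_leq_size _) _; rewrite size_nseq.
by rewrite -cats1 -[[:: M]]/(nseq 1 M) -nseqD addn1.
Qed.

(** A power without the letter [m] is confined to the last run. *)
Lemma suffix_run (m M : nat) (A u X V : seq nat) : 0 < M ->
  A ++ nseq M m ++ u = X ++ V -> m \notin V -> exists u', u = u' ++ V.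
Proof.
move=> M0 E mV; have szE := congr1 size E; rewrite !size_cat size_nseq in szE.
have sz : size V <= size u.
  rewrite leqNgt; apply/negP => uV.
  move/negP: mV; apply.
  have := congr1 (fun s => nth m s (size A + M.-1)) E.
  have h1 : (size A + M.-1 < size A) = false by lia.
  have h2 : (size A + M.-1 < size X) = false by lia.
  rewrite !nth_cat h1 h2 addKn size_nseq nth_nseq prednK // leqnn.
  have h3 : size A + M.-1 - size X < size V by lia.
  by move=> ->; exact: mem_nth.
exists (take (size u - size V) u).
have := congr1 (drop (size X)) E; rewrite (drop_size_cat _ (erefl (size X))).
have sX : size X = (size u - size V) + size (A ++ nseq M m).
  by rewrite size_cat size_nseq; lia.
have -> : A ++ nseq M m ++ u = (A ++ nseq M m) ++ u by rewrite catA.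
rewrite sX -drop_drop drop_size_cat // => VE.
by rewrite -{1}(cat_take_drop (size u - size V) u) VE.
Qed.

Lemma suffix_nseq (m j : nat) (A X V : seq nat) :
  A ++ nseq j m = X ++ V -> last m.+1 A != m -> all (pred1 m) V -> size V <= j.
Proof.
move=> E lA aV; rewrite leqNgt; apply/negP => jV.
have szE := congr1 size E; rewrite !size_cat size_nseq in szE.
case/lastP: A => [|A x] in E lA szE *.
  by move: szE => /=; lia.
rewrite last_rcons size_rcons in lA szE; move/negP: lA; apply.
have := congr1 (fun s => nth m s (size A)) E.
rewrite !nth_cat size_rcons leqnn nth_rcons ltnn eqxx ifN; last by lia.
have h3 : size A - size X < size V by lia.
by move=> ->; move/allP: aV; apply; exact: mem_nth.
Qed.

(** If [Y] contained [m] but not the whole marker, two copies of [Y] would show a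
run of fewer than [M] letters [m]. *)
Lemma period_covers_run (m M k : nat) (A u X Y : seq nat) :
  A ++ nseq M m ++ u = X ++ str_pow Y k.+2 -> u <> [::] ->
  m \notin u -> m \in Y -> M + size u <= size Y.
Proof.
move=> E u0 mu mY; rewrite leqNgt; apply/negP => YM.
have szE := congr1 size E.
rewrite size_cat size_cat size_cat size_nseq size_str_pow !mulSn in szE.
rewrite str_powSr [RHS]catA in E.
have YE : Y = drop (M + size u - size Y) (nseq M m ++ u).
  have := congr1 (drop (size (X ++ str_pow Y k.+1))) E.
  rewrite (drop_size_cat _ (erefl (size (X ++ _)))) => DE; rewrite -[LHS]DE.
  have -> : size (X ++ str_pow Y k.+1) = (M + size u - size Y) + size A.
    by rewrite size_cat size_str_pow mulSn; lia.
  by rewrite -drop_drop drop_size_cat.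
have uY : size u < size Y.
  rewrite ltnNge; apply/negP => Yu; move/negP: mu; apply.
  move: mY; rewrite YE drop_cat size_nseq ifN; last by lia.
  exact: mem_drop.
set c := M + size u - size Y in YE.
have {}YE : Y = nseq (M - c) m ++ u.
  by rewrite {1}YE drop_cat size_nseq drop_nseq ifT //; lia.
have ME : M = c + (M - c) by lia.
rewrite ME nseqD -catA -YE catA in E.
have /eqP := E; rewrite eqseq_cat; last first.
  by have := congr1 size E; rewrite !size_cat; lia.
rewrite str_powSr {2}YE => /andP[/eqP /(congr1 (last m)) ].
rewrite !last_cat -(prednK (_ : 0 < c)) /=; last by lia.
have -> x : last m (nseq x m) = m by elim: x.
case: (u) u0 mu => //= x u' _ mu uE _.
move/negP: mu; apply; rewrite uE; exact: mem_last.
Qed.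

(** At these lengths the next term of the sequence is [m] although the curling
number is smaller. *)
Definition is_cut (m l : nat) : bool := (0 < l) && (curling (gprefix m l) < m).

Section Structure.
Variables (m J : nat) (t : nat -> nat).
Hypothesis m0 : 0 < m.
Hypothesis t_mono : {homo t : x y / x < y}.
Hypothesis t_gt0 : forall e, 0 < t e.
Hypothesis t_cut : forall e, e < J -> is_cut m.+1 (t e).
Hypothesis t_all : forall e l, e < J -> l < t e -> is_cut m.+1 l ->
  exists2 e', e' < e & l = t e'.

Let b := m.+1.
Let b1 : 1 < b. Proof. by []. Qed.
Let T e := gprefix b (t e).

Definition word i := blocks m b T (ruler_seq b i).

Let mgp l : m \notin gprefix b l.
Proof. by apply/negP => /gprefix_geq; rewrite ltnn. Qed.
Let T_m e : m \notin T e. Proof. exact: mgp. Qed.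
Let T0 e : T e <> [::].
Proof. by move/(congr1 size); rewrite size_gprefix /=; have := t_gt0 e;
  lia. Qed.
Let t_leq e e' : t e <= t e' -> e <= e'.
Proof. by apply: contraTT; rewrite -!ltnNge; exact: t_mono. Qed.
Let T_inj : injective T.
Proof.
move=> e e' /(congr1 size); rewrite !size_gprefix => E.
by case: (ltngtP e e') => // /t_mono; rewrite E ltnn.
Qed.

Lemma wordS i :
  word i.+1 = word i ++ nseq b m ++ T (ruler b i.+1).
Proof. by rewrite /word ruler_seqS blocks_rcons. Qed.

Lemma size_wordS i : size (word i.+1) = size (word i) + b + t (ruler b i.+1).
Proof. by rewrite wordS !size_cat size_nseq size_gprefix addnA. Qed.

Let rJ i : i.+1 < b ^ J -> ruler b i.+1 < J.
Proof. exact: ruler_lt. Qed.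

(** A power with exponent [m.+1] at the end of a block would contain [m], since
the run is a cut of level [m.+1]. By [blocks_run_power] it comes from an
[m]-th power of the ruler sequence whose period starts with a value [e1] at
least as large as the value [e] of the last block. If [e1 = e], the power
extends to a forbidden [m.+1]-st power. If [e < e1] and [m >= 2], two
consecutive starts of periods are divisible by [b ^ e.+1], hence so is the
position of the last block, contrary to the choice of [e]. For [m = 1] there is
only one such start; then the rest of the run number [e1] is a suffix of the
run number [e], so that the run number [e1] ends in a square and is not a
cut. *)
Lemma curling_word i : i < b ^ J -> curling (word i) <= m.
Proof.
case: i => [|i] iJ.
  by apply: leq_trans (curling_leq_size _) _.
set e := ruler b i.+1; have eJ : e < J := rJ iJ.
rewrite leqNgt; apply/negP => /leq_curlingP[X [Y [Y0 E]]].
rewrite wordS -/e in E.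
have bk : m.+1 = m.-1.+2 by rewrite prednK.
have m1k : m = m.-1.+1 by rewrite prednK.
have cT e' : e' < J -> ~ ends_in_power (T e') b.
  by move=> /t_cut /andP[_]; rewrite ltnNge => /negP h /leq_curlingP.
have [mY|mY] := boolP (m \in Y); last first.
  have [u' uE] := suffix_run (ltn0Sn m) E (notin_str_pow _ mY).
  by apply: (cT e eJ); exists u', Y.
rewrite [in RHS]bk in E.
have sY := period_covers_run E (T0 (e:=e)) (T_m e) mY.
have [w0 [e1 [z [s [RE TE WE]]]]] := blocks_run_power (ltn0Sn m) T_m T0 T_inj E
  (T_m e) sY.
rewrite -m1k in RE.
set d := size (e1 :: z).
have szR := congr1 size RE; rewrite size_ruler_seq size_cat size_str_pow -/d in
  szR.
have d0 : 0 < d by [].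
have nthR l : l < m -> ruler b (size w0 + l * d).+1 = e1.
  move=> lm; have ld : l * d + d <= m * d by rewrite -mulSnr leq_mul2r lm orbT.
  rewrite -(@nth_ruler_seq b i); last by lia.
  rewrite RE nth_cat ltnNge leq_addr /= addnC addnK nth_str_pow -/d;
    last by lia.
  by rewrite modnMl.
have e1J : e1 < J.
  rewrite -(nthR 0) //; apply: rJ.
  by apply: leq_ltn_trans iJ; rewrite szR mul0n addn0 ltnS leq_addr.
have ee1 : e <= e1.
  apply: t_leq; rewrite -[t e](size_gprefix b) -[t e1](size_gprefix b).
  by rewrite -/(T e1) TE size_cat leq_addr.
(* If [s] is empty, the period starts with the value [e] itself. *)
have [s0|s0] := eqVneq s [::].
  have e1e : e1 = e by apply: T_inj; rewrite TE s0 cats0.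
  have [w1 w0E] : exists w1, w0 = w1 ++ z.
    rewrite s0 /= in WE; case: (z) WE => [|e2 z'] WE.
      by exists w0; rewrite cats0.
    have [||w1 [w2 [-> _ /(blocks_inj (ltn0Sn m) T_m T_inj) <-]]] :=
      blocks_split (ltn0Sn m) T_m T0 (esym WE).
    - exact: head_blocks.
    - by right; rewrite blocks_cons take_size_cat // size_nseq.
    by exists w1.
  apply: (@ruler_seq_powerN b i.+1) => //; exists w1, (rcons z e); split.
    by case: (z).
  rewrite ruler_seqS RE w0E e1e -!cats1 -!catA; congr (_ ++ _).
  by rewrite -[e :: z]cat1s [RHS](str_powSr _ m) [RHS]catA str_pow_rot -!catA.
have lte : e < e1.
  rewrite ltn_neqAle ee1 andbT; apply: contraNneq s0 => e1e.
  move: TE; rewrite -e1e => /(congr1 size); rewrite size_cat => sE.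
  by move/eqP: sE; rewrite -[X in X == _]addn0 eqn_add2l eq_sym size_eq0.
(* Two starts of periods are available when [m >= 2]. *)
have [m2|m2] := ltnP 1 m.
  have h0 := nthR 0 m0; have h1 := nthR 1 m2.
  have dd l : ruler b (size w0 + l * d).+1 = e1 -> b ^ e.+1 %| (size w0 + l *
    d).+1.
    by move=> E1; rewrite -leq_ruler // E1.
  have {h0} := dd _ h0; have {h1} := dd _ h1;
    rewrite mul0n mul1n addn0 => dv1 dv0.
  have dvd : b ^ e.+1 %| d by rewrite -(dvdn_addr _ dv0) addSn.
  have : b ^ e.+1 %| i.+1 by rewrite szR -addSn dvdn_addl // dvdn_mull.
  by rewrite -leq_ruler // -/e ltnn.
have m1 : m = 1 by lia.
have b2 : b = 2 by rewrite /b m1.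
rewrite m1 mul1n in szR.
have dv0 : 2 ^ e.+1 %| (size w0).+1.
  by rewrite -b2 -leq_ruler // -[size w0]addn0 -(mul0n d) nthR.
have dvi : 2 ^ e %| i.+1 by rewrite -b2 -leq_ruler.
have ndi : ~~ (2 ^ e.+1 %| i.+1) by rewrite -b2 -leq_ruler // ltnn.
have [|||w1 [w2 [w0E XE /(blocks_inj (ltn0Sn m) T_m T_inj) zE]]] :=
    @blocks_split m b T (ltn0Sn m) T_m T0 w0 (X ++ s) (blocks m b T z).
- by rewrite -WE catA.
- exact: head_blocks.
- left; rewrite last_cat; case/lastP: s s0 TE {WE} => // s y _ TE.
  rewrite last_rcons; apply: contraNneq (T_m e1) => yE.
  by rewrite TE mem_cat mem_rcons inE yE eqxx orbT.
case/lastP: w1 => [|w1 r] in w0E XE *.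
  by move: XE s0 => /=; rewrite /blocks /=; case: (X) => //; case: (s).
have szw : size w0 + 1 = (size w1).+1 + d.
  by rewrite w0E size_cat -zE size_rcons /d /=; lia.
have rE : ruler b (size w1).+1 = r.
  rewrite -(@nth_ruler_seq _ i); last by rewrite szR; lia.
  rewrite RE w0E -catA nth_cat size_rcons leqnn nth_rcons ltnn eqxx //.
(* The last block before the periodic part has the same ruler value as the last
   block of the string: both positions differ from [(size w0).+1] by [d]. *)
have re : r = e.
  have iE : i.+1 = (size w0).+1 + d by rewrite szR addSn.
  have dve0 : 2 ^ e %| (size w0).+1 by apply: dvdn_trans dv0; apply: dvdn_exp2l.
  have dd : 2 ^ e %| d by rewrite iE dvdn_addr in dvi.
  have nd : ~~ (2 ^ e.+1 %| d) by rewrite iE dvdn_addr in ndi.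
  have wE : (size w0).+1 = (size w1).+1 + d by rewrite -addn1.
  rewrite -rE; apply/eqP; rewrite eqn_leq leqNgt !leq_ruler // b2; apply/andP;
    split.
    by apply: contra nd => dw; move: dv0; rewrite wE dvdn_addr.
  by move: dve0; rewrite wE dvdn_addl.
rewrite blocks_rcons re in XE.
have ms : m \notin s.
  by have := T_m e1; rewrite TE mem_cat negb_or => /andP[].
have [s' sE] := suffix_run (ltn0Sn m) (esym XE) ms.
apply: (cT e1 e1J); exists s', s; split; first exact/eqP.
by rewrite TE sE b2 /str_pow /= cats0 catA.
Qed.

Lemma curling_word_nseq i j : 0 < j <= m -> curling (word i ++ nseq j m) <= m.
Proof.
move=> /andP[j0 jm]; rewrite leqNgt; apply/negP => /leq_curlingP[X [Y [Y0 E]]].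
have bk : m.+1 = m.-1.+2 by rewrite prednK.
have [aY|aY] := boolP (all (pred1 m) Y).
  have := @suffix_nseq m j (word i) X _ E (last_blocks (ltn0Sn m) T_m T0 _).
  rewrite size_str_pow => H.
  have : b * size Y <= j.
    exact/H/all_str_pow.
   by case: (Y) Y0 => // y Y' _ /=; rewrite /b; nia.
rewrite bk in E; apply: (@ruler_seq_powerN b i) => //.
rewrite [X in ends_in_power _ X]bk.
by apply: (blocks_nseq_power _ T_m T0 T_inj E) => //; rewrite j0.
Qed.

(** Inside a run, level [m] continues as level [m.+1] does. Powers within the run
are common to both; powers that contain [m] have exponent at most [m.+1], and
at the cuts of level [m.+1] that the run has to pass, [ruler_seq_rcons]
provides such a power with exponent [m.+1]. *)
Lemma curling_word_run i l : i.+1 < b ^ J -> l < t (ruler b i.+1) ->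
  maxn m (curling (word i ++ nseq b m ++ gprefix b l)) =
  maxn b (curling (gprefix b l)).
Proof.
move=> iJ lt; set e := ruler b i.+1 in lt; have eJ : e < J := rJ iJ.
set u := gprefix b l; set X := _ ++ _.
have Xb : b <= curling X.
  have [l0|l0] := posnP l.
    rewrite /X /u l0 /= cats0; apply: leq_trans (leq_curling_catl _ _).
    apply/leq_curlingP; exists [::], [:: m]; split=> //.
    by rewrite -[[:: m]]/(nseq 1 m) str_pow_nseq muln1.
  have [cu|cu] := ltnP (curling u) b; last first.
    by rewrite /X catA; apply: leq_trans (leq_curling_catl _ _).
  have [|e' e'e lE] := t_all eJ lt; first by rewrite /is_cut l0.
  have /ruler_seq_rcons[//|X0 [Y [Y0 E]]] : b ^ e'.+1 %| i.+1.
    by rewrite -leq_ruler.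
  apply/leq_curlingP; exists (blocks m b T X0), (blocks m b T Y); split.
    by case: (Y) Y0 => // y Y' _; rewrite blocks_cons.
  by rewrite -blocks_pow -blocks_cat -E blocks_rcons /X /u lE.
apply/eqP; rewrite eqn_leq; apply/andP; split; last first.
  rewrite geq_max !leq_max Xb orbT /=.
  by rewrite /X catA leq_curling_catl orbT.
rewrite geq_max !leq_max leqnSn /=.
case: leqP => //= bX.
have /leq_curlingP[X' [Y [Y0 E]]] := leqnn (curling X).
have [mY|mY] := boolP (m \in Y); last first.
  have [u' uE] := suffix_run (ltn0Sn m) E (notin_str_pow _ mY).
  by apply/leq_curlingP; exists u', Y.
(* Keep only the last [b.+1] copies of [Y], and look for a contradiction. *)
exfalso; rewrite -(subnK bX) str_powD catA in E.
have pw : b + size u <= size Y -> False.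
  move=> sY; have [w0 [e1 [z [s [RE _ _]]]]] :=
    blocks_run_power (ltn0Sn m) T_m T0 T_inj E (mgp l) sY.
  by apply: (@ruler_seq_powerN b i) => //; exists w0, (e1 :: z).
have [l0|l0] := posnP l; last first.
  apply/pw/(period_covers_run E) => //; last exact: mgp.
  by move/(congr1 size); rewrite size_gprefix /=; lia.
rewrite /X /u l0 [gprefix b 0]/= cats0 in E.
have [aY|aY] := boolP (all (pred1 m) Y).
  have := @suffix_nseq m b (word i) _ _ E (last_blocks (ltn0Sn m) T_m T0 _).
  rewrite size_str_pow => H.
  have : b.+1 * size Y <= b.
    exact/H/all_str_pow.
  by case: (Y) Y0 => // y Y' _ /=; rewrite /b; nia.
rewrite str_powSr [RHS]catA in E.
have [Y' [YE _ _ _]] := @cat_nseq_split m (word i) _ _ b E (last_blocks (ltn0Sn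
  m) T_m T0 _) aY.
by apply: pw; rewrite YE /u l0 addn0 size_cat size_nseq leq_addl.
Qed.

(** The block decomposition, for as many blocks as can be described by the first
[J] cuts of level [m.+1]. That every level has infinitely many cuts is deduced
from this finite form. *)
Lemma gprefix_word i : i < b ^ J -> word i = gprefix m (size (word i)).
Proof.
elim: i => // i IH iJ; have {IH} E := IH (ltnW iJ).
have Enseq j : j <= b ->
    word i ++ nseq j m = gprefix m (size (word i ++ nseq j m)).
  elim: j => [|j IH] jb; first by rewrite cats0.
  have c : curling (word i ++ nseq j m) <= m.
    case: (posnP j) => [->|j0]; last by rewrite curling_word_nseq ?j0.
    by rewrite cats0 curling_word // ltnW.
  have := gprefix_rcons (IH (ltnW jb)).
  by rewrite (maxn_idPl c) -cats1 -catA -[[:: m]]/(nseq 1 m) -nseqD addn1.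
have Erun l : l <= t (ruler b i.+1) -> word i ++ nseq b m ++ gprefix b l =
    gprefix m (size (word i ++ nseq b m ++ gprefix b l)).
  elim: l => [|l IH] lt; first by rewrite [gprefix b 0]/= cats0; exact: Enseq.
  have := gprefix_rcons (IH (ltnW lt)).
  by rewrite curling_word_run // -!rcons_cat.
by rewrite wordS; exact: Erun.
Qed.

End Structure.

(** * Counting cuts *)

Definition no_top_digit (b i : nat) : bool :=
  `[< forall f, (i %/ b ^ f) %% b != b.-1 >].

Definition count_no_top (b i : nat) : nat := count (no_top_digit b) (iota 0 i).

Lemma no_top_digitE b q r : 1 < b -> r < b ->
  no_top_digit b (q * b + r) = (r != b.-1) && no_top_digit b q.
Proof.
move=> b1 rb; have b0 : 0 < b by exact: ltnW.
have qE : (q * b + r) %/ b = q by rewrite divnMDl // divn_small // addn0.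
apply/asboolP/andP => [h|[h0 /asboolP h] [|f]].
- split.
    by have := h 0; rewrite expn0 divn1 modnMDl modn_small.
  by apply/asboolP => f; have := h f.+1; rewrite expnS divnMA qE.
- by rewrite expn0 divn1 modnMDl modn_small.
- by rewrite expnS divnMA qE.
Qed.

Lemma no_top_digit0 b : 1 < b -> no_top_digit b 0.
Proof. by move=> b1; apply/asboolP => f; rewrite div0n mod0n; lia. Qed.

Lemma count_no_topD b i k : count_no_top b (i + k) =
  count_no_top b i + count (no_top_digit b) (iota i k).
Proof. by rewrite /count_no_top iotaD count_cat. Qed.

Lemma count_no_top_mul b i : 1 < b ->
  count_no_top b (i * b) = b.-1 * count_no_top b i.
Proof.
move=> b1; elim: i => [|i IH]; first by rewrite muln0.
rewrite mulSn addnC count_no_topD IH -addn1 [in RHS]count_no_topD mulnDr.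
congr (_ + _) => /=; rewrite addn0.
have iE : iota (i * b) (b.-1 + 1) = iota (i * b) b.-1 ++ [:: i * b + b.-1].
  by rewrite iotaD.
rewrite addn1 (prednK (ltnW b1)) in iE; rewrite {}iE count_cat /=.
have -> : no_top_digit b (i * b + b.-1) = false.
  by rewrite no_top_digitE ?eqxx // prednK // ltnW.
rewrite !addn0 -[X in iota X]addn0 iotaDl count_map.
rewrite (@eq_in_count _ _ (fun=> no_top_digit b i)); last first.
  move=> r; rewrite mem_iota /= add0n => rb.
  by rewrite no_top_digitE // ?(ltn_eqF rb) //; lia.
case: (no_top_digit b i); last by rewrite count_pred0 muln0.
by rewrite count_predT size_iota muln1.
Qed.

Lemma count_no_top_exp b k : 1 < b -> count_no_top b (b ^ k) = b.-1 ^ k.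
Proof.
move=> b1; elim: k => [|k IH].
  by rewrite !expn0 /count_no_top /= no_top_digit0.
by rewrite !expnSr count_no_top_mul // IH mulnC.
Qed.

Definition ncut (m L : nat) : nat := count (is_cut m) (iota 0 L).

Lemma ncutD m L k : ncut m (L + k) = ncut m L + count (is_cut m) (iota L k).
Proof. by rewrite /ncut iotaD count_cat. Qed.

Lemma ncutS m L : ncut m L.+1 = ncut m L + is_cut m L.
Proof. by rewrite -addn1 ncutD /= addn0. Qed.

Lemma leq_ncut m L L' : L <= L' -> ncut m L <= ncut m L'.
Proof. by move=> /subnKC <-; rewrite ncutD leq_addr. Qed.

Lemma ncut_lt m L L' : ncut m L < ncut m L' -> L < L'.
Proof. by rewrite !ltnNge; apply: contra; exact: leq_ncut. Qed.

Lemma ncut_small M l : l < M -> ncut M l.+1 = l.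
Proof.
move=> lM; rewrite /ncut /= add0n (@eq_in_count _ _ predT).
  by rewrite count_predT size_iota.
move=> l'; rewrite mem_iota /is_cut => /andP[l0 lJ]; rewrite l0 /=.
by have := curling_leq_size (gprefix M l'); rewrite size_gprefix; lia.
Qed.

(** The first [J] values of [t] are the first [J] cuts. The values beyond them are
arbitrary, but [t] is increasing everywhere so that distinct values of the
ruler sequence always give distinct runs. *)
Definition cut_enum (M J : nat) (t : nat -> nat) : Prop :=
  [/\ {homo t : x y / x < y}, forall e, 0 < t e,
      forall e, e < J -> is_cut M (t e) & forall e, e < J -> ncut M (t e) = e].

(** The cut number [e] is the least length [l] such that there are more than [e]
cuts of length at most [l]. *)
Lemma cut_enum_exists M J L : J <= ncut M L -> exists t, cut_enum M J t.
Proof.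
move=> JL.
have /choice[t tP] e : exists l,
    if e < J then is_cut M l /\ ncut M l = e else l = (L + e).+1.
  case: ltnP => eJ; last by exists (L + e).+1.
  have ex : exists l, e < ncut M l.+1.
    exists L; apply: leq_trans eJ _; apply: leq_trans JL _; exact: leq_ncut.
  case: (ex_minnP ex) => l el lmin; exists l.
  have le : ncut M l <= e.
    rewrite leqNgt; apply/negP; case: l {el} lmin => [//|l] lmin /lmin.
    by rewrite ltnn.
  by move: el; rewrite ncutS; case: is_cut => /=; lia.
have tJ e : e < J -> is_cut M (t e) /\ ncut M (t e) = e by have := tP e;
  case: ltnP.
have tN e : J <= e -> t e = (L + e).+1 by have := tP e; case: ltnP.
exists t; split.
- move=> e e' ee'; case: (ltnP e' J) => e'J.
    have [_ nE] := tJ e (ltn_trans ee' e'J); have [_ nE'] := tJ e' e'J.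
    by apply: (@ncut_lt M); rewrite nE nE'.
  rewrite (tN e') //; case: (ltnP e J) => eJ; last by rewrite tN //; lia.
  have [_ nE] := tJ e eJ.
  have /ltnW: t e < L by apply: (@ncut_lt M); rewrite nE (leq_trans eJ).
  by lia.
- move=> e; case: (ltnP e J) => eJ; last by rewrite tN.
  by have [/andP[]] := tJ e eJ.
- by move=> e /tJ[].
- by move=> e /tJ[].
Qed.

Lemma cut_enum_all M J t : cut_enum M J t ->
  forall e l, e < J -> l < t e -> is_cut M l -> exists2 e', e' < e & l = t e'.
Proof.
move=> [_ _ tc tn] e l eJ lt cl.
have nl : ncut M l < e.
  by have := leq_ncut M lt; rewrite tn // ncutS cl addn1.
exists (ncut M l) => //; set e' := ncut M l.
have e'J : e' < J by apply: ltn_trans eJ.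
apply/eqP; rewrite eqn_leq leqNgt [t e' <= _]leqNgt; apply/andP; split;
  apply/negP => H.
  by have := leq_ncut M H; rewrite ncutS tc // tn // -/e'; lia.
by have := leq_ncut M H; rewrite ncutS cl tn // -/e'; lia.
Qed.

Section CutCount.
Variables (m J : nat) (t : nat -> nat).
Hypothesis m1 : 1 < m.
Hypothesis tE : cut_enum m.+1 J t.

Let b := m.+1.
Let b1 : 1 < b. Proof. exact: ltnW m1. Qed.
Let m0 : 0 < m. Proof. exact: ltnW m1. Qed.
Let t_mono : {homo t : x y / x < y}. Proof. by case: tE. Qed.
Let t_gt0 e : 0 < t e. Proof. by case: tE. Qed.
Let t_cut e : e < J -> is_cut b (t e). Proof. by case: tE => _ _ + _;
  apply. Qed.
Let t_all := cut_enum_all tE.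

Local Notation word := (word m t).
Local Notation T := (fun e => gprefix b (t e)).

Let T_m e : m \notin gprefix b (t e).
Proof. by apply/negP => /gprefix_geq; rewrite ltnn. Qed.
Let T0 e : T e <> [::].
Proof. by move/(congr1 size); rewrite size_gprefix /=; have := t_gt0 e;
  lia. Qed.
Let T_inj : injective T.
Proof.
move=> e e' /(congr1 size); rewrite !size_gprefix => E.
by case: (ltngtP e e') => // /t_mono; rewrite E ltnn.
Qed.

Lemma gprefix_word_nseq i j : i.+1 < b ^ J -> j <= b ->
  gprefix m (size (word i) + j) = word i ++ nseq j m.
Proof.
move=> iJ jb; have E := gprefix_word m0 t_mono t_gt0 t_cut t_all iJ.
have nE : nseq b m = nseq j m ++ nseq (b - j) m by rewrite -nseqD subnKC.
rewrite wordS -/b nE -!catA catA in E.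
by have := gprefix_cat E; rewrite size_cat size_nseq => <-.
Qed.

Lemma gprefix_word_run i l : i.+1 < b ^ J -> l <= t (ruler b i.+1) ->
  gprefix m (size (word i) + b + l) = word i ++ nseq b m ++ gprefix b l.
Proof.
move=> iJ jb; have E := gprefix_word m0 t_mono t_gt0 t_cut t_all iJ.
rewrite wordS in E.
set u := gprefix b _ in E; have uE : u = gprefix b l ++ drop l u.
  by rewrite -{1}(cat_take_drop l u) take_gprefix.
rewrite {}uE !catA in E; have := gprefix_cat E.
by rewrite !size_cat size_nseq size_gprefix !catA => <-.
Qed.

(** A power with exponent [m] would give an [m]-th power in the ruler sequence,
hence a digit [m]. *)
Lemma cut_word_nseq i j : i.+1 < b ^ J -> no_top_digit b i -> 0 < j < m ->
  is_cut m (size (word i) + j).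
Proof.
move=> iJ /asboolP nd /andP[j0 jm]; rewrite /is_cut addn_gt0 j0 orbT /=.
rewrite gprefix_word_nseq //; last by apply: ltnW; apply: ltnW.
rewrite ltnNge; apply/negP => /leq_curlingP[X [Y [Y0 E]]].
have mk : m = m.-2.+2 by lia.
have [aY|aY] := boolP (all (pred1 m) Y).
  have := @suffix_nseq m j (word i) _ _ E (last_blocks (ltn0Sn m) T_m T0 _).
  rewrite size_str_pow => H.
  have : m * size Y <= j.
    exact/H/all_str_pow.
  by case: (Y) Y0 => // y Y' _ /=; nia.
have {}E : word i ++ nseq j m = X ++ str_pow Y m.-2.+2 by rewrite -mk.
have /ruler_seq_power[//|//|f mf] : ends_in_power (ruler_seq b i) m.-2.+2.
  by apply: (blocks_nseq_power _ T_m T0 T_inj E) => //; lia.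
have := nd f; have := ltn_pmod (i %/ b ^ f) (ltn0Sn m); rewrite -/b /=; lia.
Qed.

(** From [m] letters [m] onwards the curling number is at least [m]: first because
of these letters, then because the next term is larger than [m]. *)
Lemma cut_word_late i j : i.+1 < b ^ J -> m <= j -> j < b + t (ruler b i.+1) ->
  ~~ is_cut m (size (word i) + j).
Proof.
move=> iJ mj jt; rewrite /is_cut; apply/nandP; right; rewrite -leqNgt.
have [jb|bj] := leqP j b.
  rewrite gprefix_word_nseq //; apply: leq_trans mj _.
  apply: leq_trans (leq_curling_catl _ _).
  apply/leq_curlingP; exists [::], [:: m]; split=> //.
  by rewrite -[[:: m]]/(nseq 1 m) str_pow_nseq muln1.
have lt : j - b < t (ruler b i.+1) by lia.
rewrite -(subnKC (ltnW bj)) addnA gprefix_word_run //; last exact: ltnW.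
have := curling_word_run m0 t_mono t_gt0 t_all iJ lt; rewrite -/b.
have : b <= maxn b (curling (gprefix b (j - b))) by exact: leq_maxl.
by rewrite /b; lia.
Qed.

(** A digit [m] yields an [m]-th power of blocks, which survives when the leading
letters of a period are appended. *)
Lemma cut_word_top_digit i j : i.+1 < b ^ J -> ~~ no_top_digit b i ->
  j < b + t (ruler b i.+1) -> ~~ is_cut m (size (word i) + j).
Proof.
move=> iJ nd jt; have [mj|jm] := leqP m j; first exact: cut_word_late.
rewrite /is_cut; apply/nandP; right; rewrite -leqNgt.
rewrite gprefix_word_nseq //; last by apply: ltnW; apply: ltnW.
have [f fP] : exists f, (i %/ b ^ f) %% b = b.-1.
  move/asboolP: nd => nd; apply: contrapT => H; apply: nd => f.
  by apply/negP => /eqP h; apply: H; exists f.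
have [X0 [Y [Y0 E]]] := ruler_seq_digit b1 fP.
have [Y' YE] : exists Y', blocks m b T Y = nseq j m ++ Y'.
  case: (Y) Y0 => // y Y1 _; rewrite blocks_cons.
  by rewrite -(subnKC (_ : j <= b)) ?nseqD -?catA; [eexists|apply: ltnW;
    apply: ltnW].
apply/leq_curlingP; exists (blocks m b T X0 ++ nseq j m), (Y' ++ nseq j m);
  split.
  move=> /(congr1 size) /= E0; have := congr1 size YE.
  rewrite !size_cat size_nseq in E0 *; case: (Y) Y0 => // y Y1 _.
  by rewrite blocks_cons size_cat size_nseq; lia.
by rewrite /word E blocks_cat blocks_pow YE -!catA str_pow_rot.
Qed.

(** The number of cuts at the ends of blocks, which the digits only bound from
above. *)
Definition extra_cuts i :=
  count (fun x => no_top_digit b x && is_cut m (size (word x))) (iota 0 i).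

Lemma ncut_word_step i j : i.+1 < b ^ J -> m <= j <= b + t (ruler b i.+1) ->
  ncut m (size (word i) + j) = ncut m (size (word i)) +
    (if no_top_digit b i then m.-1 + is_cut m (size (word i)) else 0).
Proof.
move=> iJ /andP[mj jt]; rewrite ncutD; congr (_ + _).
set s := size (word i).
rewrite -(subnKC mj) iotaD count_cat.
have -> : count (is_cut m) (iota (s + m) (j - m)) = 0.
  apply/eqP; rewrite -leqn0 leqNgt -has_count; apply/hasPn => l.
  rewrite mem_iota => /andP[l1 l2]; rewrite -(subnKC (_ : s <= l)); last by lia.
  by apply: cut_word_late => //; lia.
rewrite addn0; case: ifP => nd; last first.
  apply/eqP; rewrite -leqn0 leqNgt -has_count; apply/hasPn => l.
  rewrite mem_iota => /andP[l1 l2]; rewrite -(subnKC l1).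
  by apply: cut_word_top_digit; rewrite ?nd //; lia.
rewrite -[in LHS](prednK m0) /= prednK // addnC; congr (_ + _).
rewrite (@eq_in_count _ _ predT) ?count_predT ?size_iota // => l.
rewrite mem_iota => /andP[l1 l2] /=; rewrite -(subnKC (_ : s <= l));
  last by lia.
by apply: cut_word_nseq => //; lia.
Qed.

Lemma ncut_word i : i < b ^ J ->
  ncut m (size (word i)) = m.-1 * count_no_top b i + extra_cuts i.
Proof.
elim: i => [|i IH] iJ; first by rewrite muln0.
rewrite size_wordS -addnA ncut_word_step //; last by apply/andP; split => //;
  exact: leq_trans (leqnSn m) (leq_addr _ _).
rewrite IH ?(ltnW iJ) // -addn1 count_no_topD /extra_cuts iotaD count_cat /=.
rewrite !addn0 mulnDr; case: (no_top_digit b i) => /=;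
  rewrite ?muln1 ?muln0 ?addn0 -?addnA; last by [].
by rewrite add0n; congr (_ + _); rewrite addnCA.
Qed.

Lemma ncut_word_in i j : i.+1 < b ^ J -> m <= j <= b + t (ruler b i.+1) ->
  ncut m (size (word i) + j) = m.-1 * count_no_top b i.+1 + extra_cuts i.+1.
Proof.
move=> iJ jP; rewrite -ncut_word // size_wordS -addnA !ncut_word_step //.
by apply/andP; split => //; exact: leq_trans (leqnSn m) (leq_addr _ _).
Qed.

(** The inequality is strict because the empty string is not a cut. *)
Lemma extra_cuts_lt i : 0 < i -> extra_cuts i < count_no_top b i.
Proof.
case: i => // i _; rewrite /extra_cuts /count_no_top /= no_top_digit0 //=.
by rewrite add1n ltnS; apply: sub_count => x /andP[].
Qed.

End CutCount.

(** For a fixed number [J] of cuts, go down from a level above [J]. There the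
sequence starts with copies of its first letter, and the prefixes that are
shorter than the level are cuts because their curling number is at most their
length. If level [m.+1] has [J]
cuts, then level [m] has at least [m.-1 * m ^ J.-1 >= J] of them. *)
Lemma cuts_unbounded m J : 1 < m -> exists L, J <= ncut m L.
Proof.
have [d dE] := ubnP (J.+1 - m); elim: d m dE => // d IH m dE m1.
have [mJ|Jm] := leqP m J; last first.
  by exists J.+1; rewrite ncut_small.
have [||L /cut_enum_exists[t tE]] := IH m.+1; [by lia|exact: ltnW|].
have J0 : 0 < J by lia.
have lt : m.+1 ^ J.-1 < m.+1 ^ J by rewrite ltn_exp2l //; lia.
exists (size (word m t (m.+1 ^ J.-1))); rewrite (ncut_word m1 tE lt).
rewrite count_no_top_exp; last exact: ltnW.
rewrite -[m.+1.-1]/m.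
apply: leq_trans (leq_addr _ _).
have : J.-1 < m ^ J.-1 by apply: ltn_expl.
have : m ^ J.-1 <= m.-1 * m ^ J.-1 by apply: leq_pmull; lia.
lia.
Qed.

(** * First occurrences, level by level *)

(** Positions are counted from 0 here: [n] first occurs right after the first [q]
terms. *)
Definition first_at (m n q : nat) : Prop :=
  n \notin gprefix m q /\ maxn m (curling (gprefix m q)) = n.

(** The blocks before number [m.+1 ^ k], where [k] is the number of cuts before
[n], carry shorter cuts, which do not contain [n]. *)
Lemma first_at_step m n q J t : 0 < m -> cut_enum m.+1 J t -> m < n ->
  first_at m.+1 n q -> ncut m.+1 q.+1 < J ->
  let i := (m.+1 ^ ncut m.+1 q.+1).-1 in
  q < t (ncut m.+1 q.+1) /\ first_at m n (size (word m t i) + m.+1 + q).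
Proof.
move=> m0 tE mn [nq qn] kJ; set k := ncut m.+1 q.+1 in kJ *.
have [t_mono t_gt0 t_cut tn] := tE.
have t_all := cut_enum_all tE.
have qt : q < t k.
  rewrite ltnNge; apply/negP => tq; have : t k < q.+1 by [].
  by move/(leq_ncut m.+1); rewrite ncutS t_cut // tn // -/k; lia.
have tq e : e < k -> t e <= q.
  move=> ek; rewrite leqNgt; apply/negP => /(leq_ncut m.+1).
  by rewrite tn ?(ltn_trans ek) // -/k; lia.
have bk0 : 0 < m.+1 ^ k by rewrite expn_gt0.
have iJ : (m.+1 ^ k).-1.+1 < m.+1 ^ J by rewrite prednK // ltn_exp2l.
have rk : ruler m.+1 (m.+1 ^ k).-1.+1 = k by rewrite prednK // ruler_exp.
split=> //; rewrite /first_at.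
have E := gprefix_word m0 t_mono t_gt0 t_cut t_all iJ.
have -> : gprefix m (size (word m t (m.+1 ^ k).-1) + m.+1 + q) =
    word m t (m.+1 ^ k).-1 ++ nseq m.+1 m ++ gprefix m.+1 q.
  rewrite wordS rk in E.
  have uE : gprefix m.+1 (t k) = gprefix m.+1 q ++ drop q (gprefix m.+1 (t k)).
    by rewrite -{1}(cat_take_drop q (gprefix m.+1 (t k))) take_gprefix // ltnW.
  rewrite {}uE !catA in E; have := gprefix_cat E.
  by rewrite !size_cat size_nseq size_gprefix !catA => <-.
rewrite (curling_word_run m0 t_mono t_gt0 t_all iJ) ?rk //; split=> //.
rewrite mem_cat negb_or; apply/andP; split; last first.
  rewrite mem_cat negb_or nq andbT.
  by apply/negP => /nseqP[nm _]; rewrite nm ltnn in mn.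
apply/negP => /flattenP[B /mapP[e /mapP[x]]].
rewrite mem_iota => /andP[x0 xk] eE ->.
rewrite mem_cat mem_nseq gtn_eqF //= => nT.
have ek : e < k by rewrite eE ruler_lt //; lia.
move/negP: nq; apply; move: nT.
by rewrite -(take_gprefix m.+1 (tq _ ek)); exact: mem_take.
Qed.

(** * The lengths of the cuts *)

Lemma cut_enum_leq M J t e l : cut_enum M J t -> e < J ->
  e < ncut M l.+1 -> t e <= l.
Proof. by move=> [_ _ _ tn] eJ; rewrite -{1}(tn e eJ) => /ncut_lt. Qed.

Lemma cut_enum_small M J t e : cut_enum M J t -> e < J -> e.+1 < M ->
  t e = e.+1.
Proof.
move=> tE eJ eM; apply/eqP; rewrite eqn_leq (cut_enum_leq tE) ?ncut_small //=.
have [_ _ tc tn] := tE; have := leqnn (ncut M (t e).+1).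
rewrite {1}ncutS tc // tn // addn1 leqNgt => /negP h.
rewrite ltnNge; apply/negP => te; apply: h.
by rewrite (leq_ltn_trans (leq_ncut M (_ : (t e).+1 <= e.+1))) ?ncut_small //;
  lia.
Qed.

Lemma size_word_leq m t i B : (forall x, 0 < x <= i -> t (ruler m.+1 x) <= B) ->
  size (word m t i) <= i * (m.+1 + B).
Proof.
elim: i => // i IH tB; rewrite size_wordS mulSn.
have := tB i.+1; rewrite /= leqnn => /(_ isT) h.
have : size (word m t i) <= i * (m.+1 + B).
  by apply: IH => x /andP[x0 xi]; apply: tB; rewrite x0 leqW.
by lia.
Qed.

Lemma size_word_geq m t i : (forall e, 0 < t e) ->
  i * m.+2 <= size (word m t i).
Proof.
move=> t0; elim: i => // i IH; rewrite size_wordS mulSn.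
by have := t0 (ruler m.+1 i.+1); lia.
Qed.

(** Each increment of [s] multiplies the left side by at most [16 * m.+1] and
raises the right side to the power [m]. *)
Lemma length_arith m s : 1 < m ->
  m.+1 ^ s.+1 * (m.+1 + 16 ^ s) <= 16 ^ (m.-1 * m ^ s).
Proof.
move=> m1.
have step k : 16 * m.+1 <= 16 ^ (m.-1 * (m.-1 * m ^ k)) ->
    m.+1 ^ k.+1 * (m.+1 + 16 ^ k) <= 16 ^ (m.-1 * m ^ k) ->
    m.+1 ^ k.+2 * (m.+1 + 16 ^ k.+1) <= 16 ^ (m.-1 * m ^ k.+1).
  move=> h1 h2.
  apply: (@leq_trans ((16 * m.+1) * (m.+1 ^ k.+1 * (m.+1 + 16 ^ k)))).
    rewrite [m.+1 ^ k.+2]expnS -!mulnA [16 * _]mulnCA leq_mul2l /=.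
    rewrite mulnCA leq_mul2l; apply/orP; right.
    by rewrite mulnDr [16 ^ k.+1]expnS leq_add2r leq_pmull.
  apply: leq_trans (leq_mul h1 h2) _; rewrite -expnD leq_exp2l //.
  set q := m.-1 * m ^ k.
  by rewrite [m ^ k.+1]expnS mulnCA -/q -mulSnr prednK // ltnW.
have [m2|m2] := ltnP 2 m.
  elim: s => [|k IH]; last first.
    apply: step => //; apply: (@leq_trans (16 ^ m.+1)).
      by rewrite expnS leq_mul2l ltn_expl.
    rewrite leq_exp2l //; have mk : 0 < m ^ k by rewrite expn_gt0 (ltnW m1).
    by apply: (@leq_trans (m.-1 * m.-1));
      [nia|rewrite leq_mul2l leq_pmulr ?orbT].
  rewrite !expn0 muln1 expn1; case: m m2 {m1 step} => [|[|[|n]]] // _.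
  elim: n => [|n IH]; first by [].
  rewrite [n.+4.-1]/= [16 ^ n.+3]expnS; rewrite [n.+3.-1]/= in IH; nia.
have -> : m = 2 by lia.
have {m m1 m2 step} step k : 3 ^ k.+2 * (3 + 16 ^ k.+1) <= 16 ^ (2 ^ k.+1).
  elim: k => // k IH.
  apply: (@leq_trans (48 * (3 ^ k.+2 * (3 + 16 ^ k.+1)))).
    by rewrite [3 ^ k.+3]expnS [16 ^ k.+2]expnS; nia.
  rewrite [2 ^ k.+2]expnS mul2n -addnn expnD; apply: leq_mul => //.
  by apply: (@leq_trans (16 ^ 2)) => //;
    rewrite leq_exp2l // -[X in X <= _](expn1 2) leq_exp2l.
by case: s => // k; rewrite mul1n; exact: step.
Qed.

(** The cut number [j] has length at most [16 ^ j], at every level. The count of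
cuts places it in the first [m.+1 ^ s.+1] blocks for some [s] with
[m.-1 * m ^ s <= j], and the runs in these blocks have indices at most [s],
which is less than [j]; so induction on [j], for all levels at once, bounds
their lengths. *)
Lemma leq_cut_index m j : 1 < m -> j < ncut m (16 ^ j).+1.
Proof.
elim/ltn_ind: j m => j IH m m1.
have [jm|mj] := ltnP j.+1 m.
  apply: (@leq_trans (ncut m j.+2)); first by rewrite ncut_small.
  by apply: leq_ncut; rewrite ltnS ltn_expl.
have m0 : 0 < m by exact: ltnW.
have ex : exists s, j < m.-1 * m ^ s.
  exists j; apply: leq_trans (ltn_expl j m1) _; apply: leq_pmull; lia.
(* The exponent [s.+1] is the least one for which the blocks have enough cuts. *)
case: (ex_minnP ex) => -[|s] js smin; first by rewrite expn0 muln1 in js; lia.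
have sj : m.-1 * m ^ s <= j.
  by rewrite leqNgt; apply/negP => /smin; rewrite ltnn.
have sj' : s < j.
  apply: leq_trans (ltn_expl s m1) _; apply: leq_trans sj; apply: leq_pmull;
    lia.
have [L /cut_enum_exists[t tE]] := cuts_unbounded s.+2 (ltnW m1 : 1 < m.+1).
have b1 : 1 < m.+1 by exact: ltnW.
have bs0 : 0 < m.+1 ^ s.+1 by rewrite expn_gt0.
set i := (m.+1 ^ s.+1).-1.
have iE : i.+1 = m.+1 ^ s.+1 by rewrite prednK.
have iJ : i.+1 < m.+1 ^ s.+2 by rewrite iE ltn_exp2l.
have sz : size (word m t i) <= i * (m.+1 + 16 ^ s).
  apply: size_word_leq => x /andP[x0 xi].
  have es : ruler m.+1 x < s.+1 by apply: ruler_lt => //; rewrite -iE.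
  set e := ruler _ _ in es *.
  apply: (@leq_trans (16 ^ e)); last by rewrite leq_exp2l.
  apply: (cut_enum_leq tE); first exact: leq_trans es _.
  by apply: IH => //; lia.
apply: (@leq_trans (ncut m (size (word m t i) + m))).
  rewrite (ncut_word_in m1 tE iJ); last first.
    by rewrite leqnn /=; exact: leq_trans (leqnSn m) (leq_addr _ _).
  by rewrite iE count_no_top_exp //; apply: leq_trans js (leq_addr _ _).
apply: leq_ncut; rewrite ltnW // ltnS.
apply: leq_trans (leq_add sz (leqnn m)) _.
apply: leq_trans (_ : 16 ^ (m.-1 * m ^ s) <= _); last by rewrite leq_exp2l.
apply: leq_trans (length_arith s m1); rewrite -iE mulSnr leq_add2l.
by lia.
Qed.

(** A majorant for the total length of the runs in the first [x] blocks of
level 1. *)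
Definition ruler_weight x := \sum_(1 <= y < x.+1) 16 ^ ruler 2 y.

Lemma ruler_weightS x : ruler_weight x.+1 = ruler_weight x + 16 ^ ruler 2 x.+1.
Proof. by rewrite /ruler_weight big_nat_recr. Qed.

Lemma ruler_weight_double x : ruler_weight x.*2 = x + 16 * ruler_weight x.
Proof.
elim: x => [|x IH]; first by rewrite /ruler_weight !big_geq.
rewrite doubleS !ruler_weightS IH.
have -> : ruler 2 x.*2.+1 = 0 by apply/eqP;
  rewrite ruler_eq0 // dvdn2 /= odd_double.
have -> : ruler 2 x.*2.+2 = (ruler 2 x.+1).+1 by rewrite -doubleS -mul2n
  ruler_mul.
by rewrite expnS; lia.
Qed.

Lemma ruler_weight_exp k : ruler_weight (2 ^ k) + 2 ^ k <= 2 * 16 ^ k.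
Proof.
elim: k => [|k IH]; first by rewrite /ruler_weight big_nat1 -[1]/(2 ^ 0)
  ruler_exp.
rewrite !expnS mul2n ruler_weight_double; lia.
Qed.

Lemma size_word1_leq t k i : (forall e, e <= k -> t e <= 16 ^ e) ->
  i <= 2 ^ k -> size (word 1 t i) <= 2 * i + ruler_weight i.
Proof.
move=> tk; elim: i => // i IH ik.
rewrite size_wordS ruler_weightS; have := IH (ltnW ik).
have /tk : ruler 2 i.+1 <= k.
  by rewrite -(@leq_exp2l 2) //; apply: leq_trans ik; apply: dvdn_leq => //;
    rewrite -leq_ruler.
by lia.
Qed.

(** * Bounds for the first occurrence *)

(** By [first_at_step] the first occurrence lies in block number [m.+1 ^ k], after
the letters [m] of its marker, so exactly the cuts of the first [m.+1 ^ k]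
blocks precede it. *)
Lemma first_at_ncut m n q : 1 < m -> m < n -> first_at m.+1 n q ->
  let k := ncut m.+1 q.+1 in
  exists t q', [/\ cut_enum m.+1 k.+1 t, first_at m n q' &
    ncut m q'.+1 = m.-1 * m ^ k + extra_cuts m t (m.+1 ^ k)].
Proof.
move=> m1 mn fq k.
have [L /cut_enum_exists[t tE]] := cuts_unbounded k.+1 (ltnW m1 : 1 < m.+1).
have b1 : 1 < m.+1 by exact: ltnW.
have [qt fq'] := first_at_step (ltnW m1) tE mn fq (ltnSn k).
exists t, (size (word m t (m.+1 ^ k).-1) + m.+1 + q); split=> //.
rewrite -/k in qt fq'.
have iE : (m.+1 ^ k).-1.+1 = m.+1 ^ k by rewrite prednK // expn_gt0.
have iJ : (m.+1 ^ k).-1.+1 < m.+1 ^ k.+1 by rewrite iE ltn_exp2l.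
rewrite -addnA -addnS (ncut_word_in m1 tE iJ); last first.
  by rewrite iE ruler_exp //; lia.
by rewrite iE count_no_top_exp.
Qed.

Lemma first_at_ncut_bounds m n q : 1 < m -> m < n -> first_at m.+1 n q ->
  let k := ncut m.+1 q.+1 in
  exists2 q', first_at m n q' & m.-1 * m ^ k <= ncut m q'.+1 < m ^ k.+1.
Proof.
move=> m1 mn fq k; have [t [q' [tE fq' qE]]] := first_at_ncut m1 mn fq.
exists q' => //; rewrite qE leq_addr /=.
have := extra_cuts_lt t m1 (_ : 0 < m.+1 ^ k); rewrite expn_gt0 => /(_ isT).
rewrite count_no_top_exp; last exact: ltnW.
rewrite -[m.+1.-1]/m -/k => h.
by rewrite expnS -[X in _ < X * _](prednK (ltnW m1)) mulSnr ltn_add2l.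
Qed.

Lemma count_and_add (a c : pred nat) (s l : seq nat) : uniq l ->
  {subset l <= s} -> all (predI a (predC c)) l ->
  count (predI a c) s + size l <= count a s.
Proof.
move=> ul ls al.
have -> : count a s = count (predI a c) s + count (predI a (predC c)) s.
  by rewrite -count_predUI [X in _ + X](@eq_count _ _ pred0) ?count_pred0
    ?addn0;
  [apply: eq_count => x /=; case: (a x); case: (c x)
  |move=> x /=; case: (a x); case: (c x)].
rewrite leq_add2l -size_filter; apply: uniq_leq_size => // x xl.
by rewrite mem_filter ls // andbT; exact: (allP al).
Qed.

(** For [m = 3], the numbers 16 and 32 avoid the digit 3 in base 4, but blocks 16
and 32 carry the run 444, so their ends have curling number at least 3 and are
not cuts. Together with the empty string this removes three candidates. *)
Lemma first_at3_ncut n q : 3 < n -> first_at 4 n q ->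
  let k := ncut 4 q.+1 in 3 <= k ->
  exists2 q', first_at 3 n q' &
    2 * 3 ^ k <= ncut 3 q'.+1 /\ ncut 3 q'.+1 + 3 <= 3 ^ k.+1.
Proof.
move=> n3 fq k k3; have [t [q' [tE fq' qE]]] := @first_at_ncut 3 n q isT n3 fq.
exists q' => //; rewrite qE; split; first exact: leq_addr.
rewrite -/k in tE *.
have t2 : t 2 = 3 by apply: (cut_enum_small tE); lia.
have le64 : 64 <= 4 ^ k by rewrite -[64]/(4 ^ 3) leq_exp2l.
have ncut_end i : 0 < i < 64 -> ruler 4 i = 2 ->
    ~~ is_cut 3 (size (word 3 t i)).
  case: i => // i i64 ri; apply/nandP; right; rewrite -leqNgt.
  have [t_mono t_gt0 t_cut _] := tE.
  rewrite -(gprefix_word (isT : 0 < 3) t_mono t_gt0 t_cut (cut_enum_all tE));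
    last first.
    by rewrite expnS; lia.
  rewrite wordS ri t2 catA; apply: leq_trans (leq_curling_catl _ _).
  rewrite gprefix_nseq //; apply/leq_curlingP; exists [::], [:: 4].
  by split.
have := @count_and_add (no_top_digit 4) (fun x => is_cut 3 (size (word 3 t x)))
  (iota 0 (4 ^ k)) [:: 0; 16; 32].
rewrite -[count (no_top_digit 4) _]/(count_no_top 4 (4 ^ k)) count_no_top_exp
  // => H.
rewrite -addnA; apply: (@leq_trans (2 * 3 ^ k + 3 ^ k));
  last by rewrite expnS; lia.
rewrite leq_add2l; apply: H => //.
  by move=> x; rewrite !inE mem_iota => /or3P[] /eqP ->; lia.
have r16 : ruler 4 16 = 2 by exact: (@ruler_exp 4 2).
have r32 : ruler 4 32 = 2.
  rewrite (_ : 32 = 4 * (4 * 2)) // !ruler_mul //.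
  by congr _.+2; apply/eqP; rewrite ruler_eq0.
have nd1 : no_top_digit 4 4.
  by rewrite -[4]/(1 * 4 + 0) no_top_digitE // -[1]/(0 * 4 + 1) no_top_digitE
    // no_top_digit0.
have nd2 : no_top_digit 4 8.
  by rewrite -[8]/(2 * 4 + 0) no_top_digitE // -[2]/(0 * 4 + 2) no_top_digitE
    // no_top_digit0.
have c16 := ncut_end 16 isT r16; have c32 := ncut_end 32 isT r32.
apply/allP => x; rewrite !inE => /or3P[] /eqP ->; apply/andP; split => //.
- exact: no_top_digit0.
- by rewrite -[16]/(4 * 4 + 0) no_top_digitE.
- by rewrite -[32]/(8 * 4 + 0) no_top_digitE.
Qed.

(** The bases 2 and 16 are the growth factor of the number of blocks and the bound
of [leq_cut_index] for the growth of the runs. *)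
Lemma first_at1_length n q : 1 < n -> first_at 2 n q ->
  let k := ncut 2 q.+1 in
  exists2 q', first_at 1 n q' & 2 ^ k.+1 < q'.+1 < 2 ^ (4 * k.+1).
Proof.
move=> n1 fq k.
have [L /cut_enum_exists[t tE]] := cuts_unbounded k.+1 (isT : 1 < 2).
have [qt fq'] := @first_at_step 1 n q _ t isT tE n1 fq (ltnSn k).
rewrite -/k in qt fq'; exists (size (word 1 t (2 ^ k).-1) + 2 + q) => //.
have iE : (2 ^ k).-1.+1 = 2 ^ k by rewrite prednK // expn_gt0.
have [_ t0 _ _] := tE; have := size_word_geq 1 (2 ^ k).-1 t0.
have := size_wordS 1 t (2 ^ k).-1; rewrite iE ruler_exp // => szE.
have te e : e <= k -> t e <= 16 ^ e.
  by move=> ek; apply: (cut_enum_leq tE) => //; exact: leq_cut_index.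
have := size_word1_leq te (leqnn _); have := ruler_weight_exp k.
have : 2 ^ k <= 16 ^ k by rewrite (_ : 16 = 2 ^ 4) // -expnM leq_exp2l //
  leq_pmull.
rewrite expnM -[2 ^ 4]/16 !expnS; have : 0 < 2 ^ k by rewrite expn_gt0.
by lia.
Qed.

Lemma gijswijt_prefix_gprefix q : gijswijt_prefix q = gprefix 1 q.+1.
Proof.
elim: q => [|q IH].
  have /eqP c0 : curling [::] == 0 by rewrite -leqn0 curling_leq_size.
  by rewrite /= c0.
rewrite /gijswijt_prefix iterS -/(gijswijt_prefix q) IH.
rewrite [RHS]/= -/(gprefix 1 q.+1); congr rcons.
by apply/esym/maxn_idPr/curling_gt0 => /(congr1 size); rewrite size_rcons.
Qed.

Lemma first_at_occurrence n q : first_at 1 n q -> first_occurrence n q.+1.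
Proof.
case=> nq qn; split=> //.
  by rewrite /gijswijt gijswijt_prefix_gprefix /= last_rcons.
move=> [|r] // _; rewrite /gijswijt gijswijt_prefix_gprefix => rn.
rewrite ltnNge; apply/negP => rq; move/negP: nq; apply.
have : n \in gprefix 1 r.+1 by rewrite -rn /= last_rcons mem_rcons mem_head.
by rewrite -(take_gprefix 1 rq); exact: mem_take.
Qed.

(** * The first 4 *)

Fixpoint lcp (s1 s2 : seq nat) : nat :=
  match s1, s2 with
  | x :: s1', y :: s2' => if x == y then (lcp s1' s2').+1 else 0
  | _, _ => 0
  end.

Lemma leq_lcp s1 s2 j : j <= lcp s1 s2 <->
  [/\ j <= size s1, j <= size s2 & forall i, i < j -> nth 0 s1 i = nth 0 s2 i].
Proof.
elim: s1 s2 j => [|x s1 IH] [|y s2] [|j] //=; try by split=> [|[]].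
case: eqP => [->|xy]; last by split=> // -[_ _ /(_ 0 isT)].
rewrite !ltnS IH; split=> [[h1 h2 h]|[h1 h2 h]]; split=> //; first by case.
by move=> i ij; exact: (h i.+1).
Qed.

(** The curling number, computed on the reversed string: the longest suffix with
period [d] has length [d] plus that of the longest common prefix of the
reversed string and its shift by [d]. *)
Definition rcurling (r : seq nat) : nat :=
  foldr maxn 0 [seq (lcp r (drop d r) %/ d).+1 | d <- iota 1 (size r)].

Lemma leq_foldr_maxn k (s : seq nat) : 0 < k ->
  (k <= foldr maxn 0 s) = has (leq k) s.
Proof. by move=> k0; elim: s => [|x s IH] /=; rewrite ?leq_max ?IH //; lia. Qed.

Lemma rcurlingE (r : seq nat) : rcurling r = curling (rev r).
Proof.
suff H k : 0 < k -> k <= rcurling r <-> k <= curling (rev r).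
  apply/eqP; rewrite eqn_leq; apply/andP; split.
    by have [->//|r0] := posnP (rcurling r); have [h _] := H _ r0; apply: h.
  by have [->//|r0] := posnP (curling (rev r)); have [_ h] := H _ r0; apply: h.
case: k => // k _; rewrite leq_foldr_maxn //.
have perP d : 0 < d -> d <= size r -> k * d <= lcp r (drop d r) <->
    k.+1 * d <= size r /\
    forall x, size r - k.+1 * d <= x -> x + d < size r ->
      nth 0 (rev r) x = nth 0 (rev r) (x + d).
  move=> d0 dr; rewrite leq_lcp size_drop mulSn; split=> [[h1 h2 h]|[h1 h]].
    split=> [|x x1 x2]; first by lia.
    rewrite !nth_rev //; last by lia.
    have := h (size r - (x + d).+1); rewrite nth_drop => ->; last by lia.
    by congr nth; lia.
  split; [lia|lia|move=> i ik; rewrite nth_drop].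
  have := h (size r - (i + d).+1); rewrite !nth_rev; try lia.
  have -> : size r - (size r - (i + d).+1).+1 = d + i by lia.
  have -> : size r - (size r - (i + d).+1 + d).+1 = i by lia.
  by move=> ->//; lia.
have sr : size (rev r) = size r by rewrite size_rev.
split.
  move=> /hasP[_ /mapP[d + ->]]; rewrite mem_iota => /andP[d0 dr].
  rewrite add1n ltnS in dr.
  rewrite ltnS leq_divRL // => /perP[//|//|h1 h2].
  by apply/leq_curlingP/ends_in_powerP; exists d; rewrite sr.
move=> /leq_curlingP/ends_in_powerP[d []]; rewrite sr => d0 kd h.
have dr : d <= size r by apply: leq_trans kd; rewrite leq_pmull.
apply/hasP; exists (lcp r (drop d r) %/ d).+1.
  by apply/mapP; exists d; rewrite // mem_iota d0 add1n ltnS.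
by rewrite ltnS leq_divRL //; apply/perP.
Qed.

Definition rprefix L := iter L (fun r => maxn 1 (rcurling r) :: r) [::].

Lemma rprefixE L : rprefix L = rev (gprefix 1 L).
Proof.
elim: L => // L IH.
by rewrite /rprefix iterS -/(rprefix L) IH rcurlingE revK /= rev_rcons.
Qed.

Lemma first_at_4 : first_at 1 4 219.
Proof.
have : (4 \notin rprefix 219) && (maxn 1 (rcurling (rprefix 219)) == 4).
  by vm_compute.
by rewrite rprefixE mem_rev rcurlingE revK => /andP[h /eqP].
Qed.

(** * Towers *)

Definition ntower (bs : seq nat) (x : nat) : nat := foldr expn x bs.

Lemma leq_ntower bs x : all (leq 2) bs -> x <= ntower bs x.
Proof.
elim: bs => //= b bs IH /andP[b2 /IH h].
by apply: leq_trans h _; apply/ltnW/ltn_expl.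
Qed.

(** Descending induction on the level. At level [n.-1] the value [n] follows the
first [n] terms, which are all [n.-1], so it is preceded by [n.-2] cuts; each
further level puts one more base below the tower. *)
Lemma first_at_tower_bounds m n : 1 < m -> m < n ->
  exists2 q, first_at m n q &
    ntower (iota m (n.-1 - m)) n.-2 <= ncut m q.+1 <
    ntower (iota m (n.-1 - m)) n.-1.
Proof.
have [d dE] := ubnP (n - m); elim: d m dE => // d IH m dE m1 mn.
have [nE|nm] := eqVneq n m.+1.
  have fq : first_at m.+1 n 0 by rewrite /first_at nE; split=> //=;
    apply/maxn_idPl/ (leq_trans (curling_leq_size _)).
  have [q' fq'] := first_at_ncut_bounds m1 mn fq.
  rewrite /ncut /= expn0 expn1 muln1 => h; exists q' => //.
  by rewrite nE /= subnn.
have [|||q fq] := IH m.+1; try lia.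
set k := ncut _ _ => /andP[Lk kU].
have [|q' fq' /andP[h1 h2]] := first_at_ncut_bounds m1 _ fq; first by lia.
exists q' => //.
have -> : n.-1 - m = (n.-1 - m.+1).+1 by lia.
rewrite /=; apply/andP; split.
  apply: leq_trans h1; apply: leq_trans (_ : m ^ k <= _).
    by rewrite leq_exp2l.
  by apply: leq_pmull; lia.
by apply: leq_trans h2 _; rewrite leq_exp2l.
Qed.

(** The factor 4 in the exponent of [first_at1_length] adds 2 to the exponent of the
second 2 in the tower; the candidates eliminated by [first_at3_ncut] leave room
for that. *)
Lemma first_at_1_bounds n : 4 < n -> exists2 q, first_at 1 n q &
  ntower (2 :: iota 2 (n - 3)) (n - 2) < q.+1 <
  ntower (2 :: iota 2 (n - 3)) (n - 1).
Proof.
move=> n4; have [//|//|q4 f4] := @first_at_tower_bounds 4 n.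
set k4 := ncut _ _ => /andP[L4 U4].
have k43 : 3 <= k4.
  apply: leq_trans L4; apply: (@leq_trans n.-2); first by lia.
  by apply: leq_ntower; apply/allP => x; rewrite mem_iota => /andP[]; lia.
have [q3 f3 [L3 U3]] := first_at3_ncut (ltnW n4) f4 k43.
have [q2 f2 /andP[L2 U2]] := @first_at_ncut_bounds 2 n q3 isT (ltnW (ltnW n4))
  f3.
have [q1 f1 /andP[L1 U1]] := first_at1_length (ltnW (ltnW (ltnW n4))) f2.
exists q1 => //.
have -> : iota 2 (n - 3) = [:: 2, 3 & iota 4 (n.-1 - 4)].
  by rewrite (_ : n - 3 = (n.-1 - 4).+2) //; lia.
have -> : n - 2 = n.-2 by lia.
have -> : n - 1 = n.-1 by lia.
rewrite -/k4 in L3 U3; rewrite /=; apply/andP; split.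
  apply: leq_ltn_trans L1; rewrite leq_exp2l //; apply: leqW.
  apply: leq_trans L2; rewrite mul1n leq_exp2l //.
  apply: leq_trans L3; apply: leq_trans (_ : 3 ^ k4 <= _).
    by rewrite leq_exp2l.
  by rewrite leq_pmull.
apply: leq_trans U1 _; rewrite leq_exp2l //.
apply: (@leq_trans (2 ^ 2 * 2 ^ (ncut 3 q3.+1).+1));
  first by rewrite leq_mul2l U2.
rewrite -expnD leq_exp2l //.
apply: leq_trans (_ : 3 ^ k4.+1 <= _); first by lia.
by rewrite leq_exp2l.
Qed.

Local Open Scope ring_scope.
Import Order.TTheory GRing.Theory Num.Theory.

Lemma tower_natr (R : realType) (bs : seq nat) (x : nat) :
  tower bs (x%:R : R) = (ntower bs x)%:R.
Proof. by elim: bs => //= b bs ->; rewrite powR_mulrn // natrX. Qed.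

(** One logarithm for each base. *)
Lemma tower_between (R : realType) (bs : seq nat) (lo hi P : R) :
  all (leq 2) bs -> tower bs lo < P -> P < tower bs hi ->
  exists a, [/\ lo < a, a < hi & P = tower bs a].
Proof.
elim: bs P => [|b bs IH] P /=; first by move=> _ h1 h2; exists P.
move=> /andP[b2 bs2] lP Ph.
have b0 : (b%:R : R) != 0 by rewrite pnatr_eq0; lia.
have lb : 0 < ln (b%:R : R) by rewrite ln_gt0 // ltr1n.
have P0 : 0 < P by apply: le_lt_trans lP; exact: powR_ge0.
have PE : P = powR b%:R (ln P / ln b%:R).
  by rewrite /powR (negbTE b0) mulfVK ?gt_eqF // lnK.
have mono x y : powR b%:R x < powR b%:R y -> x < y :> R.
  by rewrite /powR (negbTE b0) ltr_expR ltr_pM2r.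
have [||a [h1 h2 E]] := IH (ln P / ln b%:R) bs2.
- by apply: mono; rewrite -PE.
- by apply: mono; rewrite -PE.
by exists a; split=> //; rewrite -E.
Qed.

Theorem theorem1 (R : realType) (n : nat) (hn : (4 <= n)%N) :
  exists (alpha : R) (p : nat),
    [/\ n%:R - 2 < alpha, alpha < n%:R - 1,
        first_occurrence n p
      & p%:R = tower (2%N :: iota 2 (n - 3)) alpha].
Proof.
have [q fq /andP[Lq Uq]] : exists2 q, first_at 1 n q &
    (ntower (2 :: iota 2 (n - 3)) (n - 2) < q.+1 <
     ntower (2 :: iota 2 (n - 3)) (n - 1))%N.
  move: hn; rewrite leq_eqVlt => /predU1P[<-|]; last exact: first_at_1_bounds.
  by exists 219%N; [exact: first_at_4|vm_compute].
have bs2 : all (leq 2) (2%N :: iota 2 (n - 3)).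
  by rewrite /=; apply/allP => x; rewrite mem_iota => /andP[].
have [||a [h1 h2 E]] := @tower_between R _ (n - 2)%N%:R (n - 1)%N%:R q.+1%:R
  bs2.
- by rewrite tower_natr ltr_nat.
- by rewrite tower_natr ltr_nat.
exists a, q.+1; split=> //.
- by rewrite -natrB //; apply: leq_trans hn.
- by rewrite -(natrB _ (_ : 1 <= n)%N) //; apply: leq_trans hn.
- exact: first_at_occurrence.
Qed.
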